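(* (i) For any $0<\delta<1$ there exists $C_\delta>0$ such that for all $v\neq v^*$ in $\mathbb{R}^3$ and all $i,j\in\{1,2,3\}$, $$\left|B_{ij}(v,v-v^* )\right|\le\frac{e^{\frac12|v_R|^2}}{|v-v^*|}\,C_\delta\left[1+|v_R|\right]^{-3-\delta}.$$ (ii) Moreover, for any $0<q<1$ there exists $C_q>0$ such that for all $u\in\mathbb{R}^3$ and all $v\ne v^*$ in $\mathbb{R}^3$, $$u^t\,{\bf B}(v,v-v^* )\,u\ge\frac{|\{I-P_{v-v^*}\}u|^2}{C_q}\,\frac{e^{\frac q2|v_R|^2}}{|v-v^*|}\left[1+|v_R|\right]^{-3}.$$
   Context: Fix a wavenumber cutoff $0<k_0<\infty$; all other physical constants are normalized to one. Let $\mu(v)=(2\pi)^{-3/2}e^{-|v|^2/2}$ on $\mathbb{R}^3$. Dispersion function at Maxwellian: for $k\neq0$, $\hat k=k/|k|$, $$\epsilon(|k|,\hat k\cdot v)=1+\frac1{|k|^2}\lim_{\eta\downarrow0}\int_{\mathbb{R}^3}\frac{k\cdot\nabla\mu(u)}{k\cdot(v-u)-i\eta}du=1+|k|^{-2}\left(\Psi_R(\hat k\cdot v)+i\Psi_I(\hat k\cdot v)\right),$$ with $\Psi_R(x)=1-xe^{-x^2/2}\int_0^xe^{y^2/2}dy$ and $\Psi_I(x)=-\sqrt{\pi/2}\,x e^{-x^2/2}$. Balescu-Lenard kernel at Maxwellian: for $v\ne v^*$, $$B_{ij}(v,v-v^* )=\int_{|k|\le k_0}\frac{k_ik_j}{|k|^4}\frac{\delta(k\cdot[v-v^*])}{|\epsilon(|k|,\hat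 k\cdot v)|^2}dk,$$ i.e. $|v-v^*|^{-1}$ times the two-dimensional integral of $\frac{k_ik_j}{|k|^4|\epsilon|^2}$ over $\{k\perp v-v^*,\ |k|\le k_0\}$; ${\bf B}=(B_{ij})_{1\le i,j\le3}$. The quantity $|v_R|\ge0$ is the magnitude of the component of $v$ perpendicular to the relative velocity: $|v_R|^2=|v|^2-\left(\frac{v-v^*}{|v-v^*|}\cdot v\right)^2$. For $z\ne0$, $P_zu=\left(\frac z{|z|}\cdot u\right)\frac z{|z|}$ is the projection of $u$ onto the direction $z$. The constants $C_\delta$, $C_q$ do not depend on $v,v^*,u$. *)

(* Defs.v *)
From HB Require Import structures.
From mathcomp Require Import all_boot all_order all_algebra.
From mathcomp Require Import all_classical all_reals all_analysis.
From mathcomp.real_closed Require Import complex.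
From mathcomp Require Import ring lra.

Set Implicit Arguments.
Unset Strict Implicit.
Unset Printing Implicit Defensive.

Import Order.TTheory GRing.Theory Num.Theory.
Import numFieldNormedType.Exports.

Local Open Scope classical_set_scope.
Local Open Scope ring_scope.
Local Open Scope complex_scope.

Section Kernel.
Context {R : realType}.

(* The library norm `|x| on column vectors is the sup norm, hence enorm. *)
Definition dot (x y : 'cV[R]_3) : R := \sum_(i < 3) x i 0 * y i 0.
Definition enorm (x : 'cV[R]_3) : R := Num.sqrt (dot x x).

Definition dirproj (z u : 'cV[R]_3) : 'cV[R]_3 :=
  dot ((enorm z)^-1 *: z) u *: ((enorm z)^-1 *: z).

Definition grad (f : 'cV[R]_3 -> R) (u : 'cV[R]_3) : 'cV[R]_3 :=
  \col_(i < 3) 'D_(delta_mx i 0) f u.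

Local Notation lambda := (@lebesgue_measure R).

Definition vec3 (p : R * R * R) : 'cV[R]_3 :=
  \col_(i < 3) nth 0 [:: p.1.1; p.1.2; p.2] i.

Definition integral3C (f : 'cV[R]_3 -> R[i]) : R[i] :=
  (\int[(lambda \x lambda \x lambda)%E]_p complex.Re (f (vec3 p))) +i*
  (\int[(lambda \x lambda \x lambda)%E]_p complex.Im (f (vec3 p))).

Definition lim_right0C (f : R -> R[i]) : R[i] :=
  lim (complex.Re (f h) @[h --> 0^'+]) +i* lim (complex.Im (f h) @[h --> 0^'+]).

Definition maxwellian (v : 'cV[R]_3) : R :=
  (2 * pi) `^ (- (3 / 2)) * expR (- (enorm v ^+ 2 / 2)).

(* It depends on (k, v) only through |k| and (k/|k|).v, because maxwellian is
   radial. *)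
Definition dispersion (k v : 'cV[R]_3) : R[i] :=
  1 + ((enorm k ^- 2)%:C *
       lim_right0C (fun h => integral3C (fun u =>
         (dot k (grad maxwellian u))%:C / (dot k (v - u) -i* h)))).

Definition orthonormal_frame (z : 'cV[R]_3) (e : 'cV[R]_3 * 'cV[R]_3) : Prop :=
  [/\ dot e.1 z = 0, dot e.2 z = 0, dot e.1 e.1 = 1, dot e.2 e.2 = 1
    & dot e.1 e.2 = 0].

(* Some orthonormal basis of the plane orthogonal to z, for z <> 0; by rotation
   invariance of area, disc_integral does not depend on which one is chosen. *)
Definition frame (z : 'cV[R]_3) : 'cV[R]_3 * 'cV[R]_3 :=
  xget (0, 0) [set e | orthonormal_frame z e].

Lemma frameP (z : 'cV[R]_3) : z <> 0 -> orthonormal_frame z (frame z).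
Proof.
move=> z0; suff [e he] : exists e, orthonormal_frame z e.
  by rewrite /frame; case: xgetP => [y _ //|/(_ e)]; case.
pose mk a b c : 'cV[R]_3 := \col_(i < 3) nth 0 [:: a; b; c] i.
have dotE x y : dot x y = x 0 0 * y 0 0 + x 1 0 * y 1 0 + x 2%R 0 * y 2%R 0.
  rewrite /dot !big_ord_recl big_ord0 addr0 addrA.
  by congr (_ + _ * _ + _ * _); congr (_ _ 0); apply: val_inj.
have mkE a b c : (mk a b c 0 0 = a) * (mk a b c 1 0 = b) * (mk a b c 2%R 0 = c).
  by rewrite /mk !mxE.
set a := z 0 0; set b := z 1 0; set c := z 2%R 0.
have [ab0|ab0] := eqVneq (a ^+ 2 + b ^+ 2) 0.
  have [a0 b0] : a = 0 /\ b = 0.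
    by move/eqP: ab0; rewrite paddr_eq0 ?sqr_ge0// !sqrf_eq0 => /andP[/eqP ? /eqP ?].
  exists (mk 1 0 0, mk 0 1 0).
  by split; rewrite dotE /= !mkE -/a -/b -/c ?a0 ?b0; ring.
pose s := Num.sqrt (a ^+ 2 + b ^+ 2).
pose t := Num.sqrt (a ^+ 2 + b ^+ 2 + c ^+ 2).
have ab_gt0 : 0 < a ^+ 2 + b ^+ 2 by rewrite lt_def ab0 addr_ge0 ?sqr_ge0.
have abc_gt0 : 0 < a ^+ 2 + b ^+ 2 + c ^+ 2 by rewrite ltr_wpDr ?sqr_ge0.
have s2 : s ^+ 2 = a ^+ 2 + b ^+ 2 by rewrite sqr_sqrtr// ltW.
have t2 : t ^+ 2 = a ^+ 2 + b ^+ 2 + c ^+ 2 by rewrite sqr_sqrtr// ltW.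
have sn : s != 0 by rewrite gt_eqF// sqrtr_gt0.
have tn : t != 0 by rewrite gt_eqF// sqrtr_gt0.
exists (mk (- b / s) (a / s) 0,
        mk (- (a * c) / (s * t)) (- (b * c) / (s * t)) (s / t)).
split; rewrite dotE /= !mkE -/a -/b -/c.
- by field.
- transitivity (c * (s ^+ 2 - (a ^+ 2 + b ^+ 2)) / (s * t)).
    by field; rewrite ?sn ?tn.
  by rewrite s2 subrr mulr0 mul0r.
- transitivity ((a ^+ 2 + b ^+ 2) / s ^+ 2); first by field; rewrite ?sn.
  by rewrite s2 divff.
- transitivity ((c ^+ 2 * (a ^+ 2 + b ^+ 2) + s ^+ 2 * s ^+ 2)
                / (s ^+ 2 * t ^+ 2)).
    by field; rewrite ?sn ?tn.
  by rewrite s2 t2; field; rewrite ab0 gt_eqF.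
- by field; rewrite ?sn ?tn.
Qed.

Definition plane_vec (z : 'cV[R]_3) (p : R * R) : 'cV[R]_3 :=
  p.1 *: (frame z).1 + p.2 *: (frame z).2.

Definition disc_integral (k0 : R) (z : 'cV[R]_3) (f : 'cV[R]_3 -> R) : R :=
  \int[(lambda \x lambda)%E]_(p in [set p | enorm (plane_vec z p) <= k0])
    f (plane_vec z p).

(* For z <> 0, the measure delta(k.z) dk is |z|^-1 times the area measure of
   the plane orthogonal to z. *)
Definition BLkernel (k0 : R) (v z : 'cV[R]_3) : 'M[R]_3 :=
  \matrix_(i < 3, j < 3)
    ((enorm z)^-1 * disc_integral k0 z (fun k =>
       k i 0 * k j 0 /
       (enorm k ^+ 4 * ComplexField.Normc.normc (dispersion k v) ^+ 2))).

(* |v_R|, where z stands for v - v^*. *)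
Definition vR (v z : 'cV[R]_3) : R :=
  Num.sqrt (enorm v ^+ 2 - dot ((enorm z)^-1 *: z) v ^+ 2).

End Kernel.

(* Main.v *)
From HB Require Import structures.
Require Import Defs.
From mathcomp Require Import all_boot all_order all_algebra.
From mathcomp Require Import all_classical all_reals all_analysis.
From mathcomp.real_closed Require Import complex.
From mathcomp Require Import measurable_realfun ring lra.

(** Put z = v - vs, let r = vR v z be the length of the component of v in the
    plane orthogonal to z, and let k = s w, with w a unit vector, run through
    this plane.  The dispersion function depends only on s and on x = w.v, where
    |x| <= r, so that in polar coordinates |z| B is the integral over the unit
    circle of w w^t A(x), with

      A(x) = int_0^k0 s^3 ds / ((s^2 + PsiR x)^2 + (PsiI x)^2).

    For large |x| the real part PsiR x behaves like - 1/x^2, while PsiI x is of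
    the size of |x| exp(- x^2/2).  The denominator thus nearly vanishes at
    s^2 = - PsiR x, and this resonance makes A(x) comparable, from above and
    from below, to exp(x^2/2) / (1 + |x|)^3: lemmas [radial_integral_le] and
    [radial_integral_ge].

    Upper bound.  The weight exp(x^2/2) is largest for w parallel to the
    projection of v, and falls off as the angle leaves a sector of opening 1/r.
    Hence |z| |B_ij| is at most C exp(r^2/2) (1 + r)^-4, which is stronger than
    the claim for every delta < 1: lemma [planar_integral_le].

    Lower bound.  Keep only directions w with x^2 >= q r^2.  They contain a
    sector whose opening depends on q alone; on it the weight is at least
    exp(q r^2/2) / (1 + r)^3, and the integral of (u.w)^2 is at least a fixed
    fraction of the squared length of the projection of u on the plane: lemma
    [planar_integral_ge].

    The angle is replaced by the slope t = p2/p1 in a frame (e1, e2) of the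
    plane.  Then dtheta = dt/(1 + t^2), and the passage from the disc to the
    coordinates (p1, t) only needs Tonelli and affine substitutions on the line:
    lemma [planar_integral].  The orthogonal frame is arbitrary; the bounds are
    uniform in the direction of the projection of v because, with
    r^2 = x^2 + y^2, the product (1 + t^2) (1 + y^2) is a quadratic polynomial
    in t, whose inverse has the explicit integral pi / sqrt(1 + r^2).

    The formula for the dispersion function, [dispersionE], comes from three
    facts.  The projection of a Gaussian on a line is a Gaussian (completing the
    square), which reduces the integral over the space to one over the line.
    Folding this integral around its pole removes the singularity, so that
    dominated convergence gives the limit.  Finally the folded integral is
    evaluated by Tonelli as 1 - y exp(- y^2/2) int_0^y exp(t^2/2) dt, from which
    the behaviour of PsiR is read off. *)

Import Order.TTheory GRing.Theory Num.Theory.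
Import numFieldNormedType.Exports.
Local Open Scope ring_scope.
Local Open Scope classical_set_scope.
Set Implicit Arguments.
Unset Strict Implicit.
Unset Printing Implicit Defensive.

(** * Substitutions, derivatives and measurability on the line *)

Section AffineSubstitution.
Context {R : realType}.
Local Notation mu := (@lebesgue_measure R).

Let affine (a b : R) : R -> measurableTypeR R := fun x => a * x + b.

Lemma measurable_affine (a b : R) : measurable_fun setT (affine a b).
Proof. by apply: measurable_funD => //; apply: measurable_funM. Qed.

Let affine_preimage (a b c d : R) : a != 0 ->
  affine a b @^-1` `]c, d] =
  if 0 < a then `](c - b) / a, (d - b) / a]%classic
  else `[(d - b) / a, (c - b) / a[%classic.
Proof.
move=> a0; apply/seteqP; rewrite /affine; case: ifPn => [ap|an].
  by split=> x /=; rewrite !in_itv/= ltr_pdivrMr// ler_pdivlMr// [x * a]mulrC ltrBlDr lerBrDr.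
have {}an : a < 0 by rewrite lt_neqAle a0/= leNgt.
split=> x /=; rewrite !in_itv/= ltr_ndivlMr// ler_ndivrMr// [x * a]mulrC ltrBlDr lerBrDr;
  by rewrite andbC.
Qed.

(** The image of Lebesgue measure by an affine map, rescaled, agrees with
    Lebesgue measure on intervals, hence everywhere. *)
Lemma ge0_integral_affine (f : R -> \bar R) (a b : R) : a != 0 ->
  measurable_fun setT f -> (forall x, 0 <= f x)%E ->
  (\int[mu]_x f (a * x + b)%R = (`|a|^-1)%:E * \int[mu]_x f x)%E.
Proof.
move=> a0 mf f0.
have na0 : 0 < `|a| by rewrite normr_gt0.
pose mp : measurable_fun setT (affine a b) := @measurable_affine a b.
pose m0 : {measure set (measurableTypeR R) -> \bar R} :=
  measure_function_pushforward__canonical__measure_function_Measure mu mp.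
pose m : {measure set (measurableTypeR R) -> \bar R} := mscale (NngNum (ltW na0)) m0.
have mE A : measurable A -> mu A = m A.
  apply: lebesgue_measure_unique => _ [[c d] _ <-]/=.
  rewrite /m /mscale /= /mscale /= /pushforward affine_preimage//.
  have key : ((d - b) / a - (c - b) / a) * a = d - c by field.
  case: ifPn => [ap|an]; rewrite !lebesgue_measure_itv/= !lte_fin.
    rewrite ltr_pM2r ?invr_gt0// ltrD2r; case: ifPn => cd; last by rewrite mule0.
    by rewrite gtr0_norm// -!EFinB -EFinM mulrC key.
  have {}an : a < 0 by rewrite lt_neqAle a0/= leNgt.
  rewrite ltr_nM2r ?invr_lt0// ltrD2r; case: ifPn => cd; last by rewrite mule0.
  by rewrite ltr0_norm// -!EFinB -EFinM mulNr mulrC -mulNr opprB key.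
rewrite [X in (_ * X)%E](eq_measure_integral m); last by move=> A mA _; exact: mE.
rewrite ge0_integral_mscale//.
rewrite ge0_integral_pushforward//=.
by rewrite muleA -EFinM mulVf ?mul1e ?gt_eqF.
Qed.

End AffineSubstitution.

Section PointwiseDerivatives.
Context {R : realType}.
Implicit Types f g : R -> R.

Lemma is_derive_exprf n (x : R) : is_derive x 1 (fun t => t ^+ n) (n%:R * x ^+ n.-1).
Proof.
have := @is_deriveX R R^o id n x 1 1 (is_derive_id _ _).
by rewrite /GRing.scale/= mulr1 exprfctE.
Qed.

Lemma is_derive_compf f g (x a b : R) : is_derive (g x) 1 f a -> is_derive x 1 g b ->
  is_derive x 1 (fun t => f (g t)) (a * b).
Proof. by move=> fa gb; exact: (@is_derive1_comp _ f g). Qed.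

Lemma is_derive_invf f (x a : R) : f x != 0 -> is_derive x 1 f a ->
  is_derive x 1 (fun t => (f t)^-1) (- f x ^- 2 * a).
Proof. by move=> fx fa; exact: is_deriveV. Qed.

End PointwiseDerivatives.

Section MeasurableInverse.
Context d (T : measurableType d) (R : realType).

(** Writing 1/f as f times (f^2) to the power -1 also covers the zeros of f. *)
Lemma measurable_funV (D : set T) (f : T -> R) : measurable_fun D f ->
  measurable_fun D (fun x => (f x)^-1).
Proof.
move=> mf.
have -> : (fun x => (f x)^-1) = (fun x => f x * (f x ^+ 2) `^ (-1)).
  apply/funext => x; have [->|fx0] := eqVneq (f x) 0; first by rewrite invr0 mul0r.
  by rewrite powR_inv1 ?sqr_ge0// expr2 invfM mulrA divff// mul1r.
apply: measurable_funM => //.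
apply: (measurableT_comp (f := @powR R ^~ (-1))); first exact: measurable_powR.
exact: measurable_funX.
Qed.

End MeasurableInverse.

Section SignedAffineSubstitution.
Context {R : realType}.
Local Notation mu := (@lebesgue_measure R).
Variables (f : R -> R) (a b : R).
Hypotheses (a0 : a != 0) (fi : mu.-integrable setT (EFin \o f)).

Let mf : measurable_fun setT (EFin \o f).
Proof. by case/integrableP: fi. Qed.

Lemma integrable_affine : mu.-integrable setT (fun x => (f (a * x + b))%:E).
Proof.
apply/integrableP; split.
  exact: (measurableT_comp mf (@measurable_affine R a b)).
have := @ge0_integral_affine R (fun x => `|(EFin \o f) x|)%E a b a0.
move=> /(_ (measurableT_comp (@abse_measurable _ setT) mf) (fun x => abse_ge0 _)).
rewrite /= => ->; case/integrableP: fi => _ fioo.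
by rewrite lte_mul_pinfty// lee_fin invr_ge0.
Qed.

Lemma integral_affine :
  (\int[mu]_x (f (a * x + b))%:E = (`|a|^-1)%:E * \int[mu]_x (f x)%:E)%E.
Proof.
rewrite integralE [in RHS]integralE muleBr//; last first.
  exact: integrable_add_def.
have mp : measurable_fun setT ((EFin \o f)^\+)%E by exact: measurable_funepos.
have mn : measurable_fun setT ((EFin \o f)^\-)%E by exact: measurable_funeneg.
congr (_ - _)%E.
- rewrite -[RHS](ge0_integral_affine b a0 mp (funepos_ge0 _)).
  by apply: eq_integral => x _; rewrite !funeposE.
- rewrite -[RHS](ge0_integral_affine b a0 mn (funeneg_ge0 _)).
  by apply: eq_integral => x _; rewrite !funenegE.
Qed.

Lemma Rintegral_affine :
  \int[mu]_x f (a * x + b) = `|a|^-1 * \int[mu]_x f x.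
Proof.
by rewrite /Rintegral integral_affine fineM//; exact: integrable_fin_num.
Qed.

End SignedAffineSubstitution.

Section FTC2.
Context {R : realType}.
Local Notation mu := (@lebesgue_measure R).

Lemma derivable_continuous (f : R -> R) :
  (forall x : R, derivable f x 1) -> continuous f.
Proof. by move=> df x; exact/differentiable_continuous/derivable1_diffP/df. Qed.

Lemma integral_is_derive_itv (f F : R -> R) (a b : R) : a <= b ->
  (forall x : R, a <= x <= b -> {for x, continuous f}) ->
  (forall x : R, a <= x <= b -> is_derive x 1 F (f x)) ->
  (\int[mu]_(x in `[a, b]) (f x)%:E = (F b - F a)%:E)%E.
Proof.
move=> ab cf dF.
have cF (x : R) : a <= x <= b -> {for x, continuous F}.
  by move=> /dF dFx; apply: differentiable_continuous; apply/derivable1_diffP; apply: ex_derive.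
move: ab; rewrite le_eqVlt => /predU1P[ab|ab].
  by rewrite ab set_itv1 integral_set1 subrr.
rewrite (continuous_FTC2 ab _ (F := F)) ?EFinB//.
- by apply: continuous_in_subspaceT => x /[!inE]/= /[!in_itv]/=; exact: cf.
- split.
  + move=> x; rewrite in_itv/= => /andP[ax xb]; have dFx := dF x.
    by apply: ex_derive; apply: dFx; rewrite !ltW.
  + by apply: cvg_at_right_filter; apply: cF; rewrite lexx ltW.
  + by apply: cvg_at_left_filter; apply: cF; rewrite lexx ltW.
- move=> x; rewrite in_itv/= => /andP[ax xb].
  by rewrite derive1E; have dFx := dF x; apply: derive_val; apply: dFx; rewrite !ltW.
Qed.

Lemma integral_is_derive (f F : R -> R) (a b : R) : a <= b -> continuous f ->
  (forall x : R, is_derive x 1 F (f x)) ->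
  (\int[mu]_(x in `[a, b]) (f x)%:E = (F b - F a)%:E)%E.
Proof. by move=> ab cf dF; apply: integral_is_derive_itv => // x _; exact: cf. Qed.

End FTC2.

(** * Projections of Gaussians *)

Section GaussianProjection.
Context {R : realType}.
Local Notation mu := (@lebesgue_measure R).

Definition gauss (x : R) : R := (Num.sqrt (2 * pi))^-1 * expR (- (x ^+ 2 / 2)).

Lemma gauss_gt0 x : 0 < gauss x.
Proof. by rewrite mulr_gt0 ?expR_gt0// invr_gt0 sqrtr_gt0 mulr_gt0// pi_gt0. Qed.

Lemma gauss_ge0 x : 0 <= gauss x.
Proof. exact/ltW/gauss_gt0. Qed.

Lemma gauss_normal_pdf : gauss = normal_pdf 0 1.
Proof.
apply/funext => x; rewrite normal_pdfE ?oner_neq0// /gauss.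
rewrite /= /normal_peak /normal_fun !expr1n mul1r subr0.
by rewrite -mulNr mulr_natl.
Qed.

Lemma measurable_gauss : measurable_fun setT gauss.
Proof. by rewrite gauss_normal_pdf; exact: measurable_normal_pdf. Qed.

Lemma integral_gauss : (\int[mu]_x (gauss x)%:E = 1)%E.
Proof. by rewrite gauss_normal_pdf integral_normal_pdf. Qed.

Lemma gaussN x : gauss (- x) = gauss x.
Proof. by rewrite /gauss sqrrN. Qed.

(** Completing the square in x: up to a factor free of x, the product of two
    Gaussians is a Gaussian in x. *)
Lemma gauss_mul a b c t x : b != 0 -> c != 0 -> c ^+ 2 = a ^+ 2 + b ^+ 2 ->
  gauss x * gauss ((t - a * x) / b) =
  gauss (t / c) * gauss (c / b * x - a * t / (b * c)).
Proof.
move=> b0 c0 cab; rewrite /gauss !mulrA -2![_ * expR _ * _ * _]mulrA.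
rewrite ![_ * expR _ * _]mulrAC -!mulrA -!expRD; congr (_ * (_ * expR _)).
have a2 : a ^+ 2 = c ^+ 2 - b ^+ 2 by rewrite cab addrK.
suff : (t - a * x) ^+ 2 / b ^+ 2 + x ^+ 2 =
    t ^+ 2 / c ^+ 2 + (c / b * x - a * t / (b * c)) ^+ 2.
  rewrite -!expr_div_n => h; lra.
have -> : (c / b * x - a * t / (b * c)) ^+ 2 =
  (c ^+ 2 * x ^+ 2 - 2 * a * t * x + a ^+ 2 * t ^+ 2 / c ^+ 2) / b ^+ 2.
  by field; rewrite ?b0 ?c0.
have -> : (t - a * x) ^+ 2 = t ^+ 2 - 2 * a * t * x + a ^+ 2 * x ^+ 2 by ring.
by rewrite a2; field; rewrite b0 c0.
Qed.

(** Rotation invariance of the plane Gaussian, for functions of one linear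
    form.  Substituting t = a x + b y for y and integrating x out with
    [gauss_mul] avoids any change of variables in the plane. *)
Lemma gauss_proj2 (psi : R -> R) (a b : R) : measurable_fun setT psi ->
  (forall x, 0 <= psi x) ->
  (\int[mu]_x \int[mu]_y (psi (a * x + b * y) * (gauss x * gauss y))%:E =
   \int[mu]_t (psi (Num.sqrt (a ^+ 2 + b ^+ 2) * t) * gauss t)%:E)%E.
Proof.
move=> mpsi psi0; have mg := measurable_gauss.
(* For b = 0 only a reflection is left, as sqrt(a^2) = |a|. *)
have [->|b0] := eqVneq b 0.
  transitivity (\int[mu]_x (psi (a * x) * gauss x)%:E)%E.
    apply: eq_integral => x _.
    under eq_integral do rewrite mul0r addr0 mulrA EFinM.
    rewrite ge0_integralZl//.
    - by rewrite integral_gauss mule1.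
    - exact/measurable_EFinP.
    - by move=> y _; rewrite lee_fin gauss_ge0.
    - by rewrite lee_fin mulr_ge0 ?gauss_ge0.
  rewrite expr0n addr0 sqrtr_sqr.
  have [a0|a0] := leP 0 a; first by rewrite ger0_norm.
  rewrite ltr0_norm//.
  have mf : measurable_fun setT (fun x => (psi (a * x) * gauss x)%:E).
    apply/measurable_EFinP; apply: measurable_funM => //.
    by apply: measurableT_comp => //; apply: measurable_funM.
  have f0 x : (0 <= (psi (a * x)%R * gauss x)%:E)%E by rewrite lee_fin mulr_ge0 ?gauss_ge0.
  have n10 : -1 != 0 :> R by rewrite oppr_eq0 oner_neq0.
  have := ge0_integral_affine 0 n10 mf f0.
  rewrite normrN normr1 invr1 mul1e => E; rewrite -{}E.
  by apply: eq_integral => x _; rewrite addr0 mulN1r mulrN mulNr gaussN.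
set c := Num.sqrt _.
have c2 : c ^+ 2 = a ^+ 2 + b ^+ 2 by rewrite sqr_sqrtr// addr_ge0 ?sqr_ge0.
have cp : 0 < c by rewrite sqrtr_gt0 ltr_wpDl ?sqr_ge0// exprn_even_gt0.
have c0 : c != 0 by rewrite gt_eqF.
pose G (p : R * R) := psi p.2 * (gauss p.1 * gauss ((p.2 - a * p.1) / b)).
have mG : measurable_fun setT G.
  apply: measurable_funM; first exact: measurableT_comp.
  apply: measurable_funM; first exact: measurableT_comp.
  apply: measurableT_comp => //; apply: measurable_funM => //.
  by apply: measurable_funB => //; apply: measurable_funM.
have G0 p : 0 <= G p by rewrite !mulr_ge0 ?gauss_ge0.
have mGE : measurable_fun setT (EFin \o G) by exact/measurable_EFinP.
have GE0 p : (0 <= (EFin \o G) p)%E by rewrite lee_fin.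
have mGx x : measurable_fun setT (fun y => (G (x, y))%:E).
  by apply/measurable_EFinP; apply: measurableT_comp.
have mGy y : measurable_fun setT (fun x => (G (x, y))%:E).
  by apply/measurable_EFinP; apply: measurableT_comp.
have nb0 : 0 <= `|b|^-1 by rewrite invr_ge0.
transitivity (\int[mu]_x ((`|b|^-1)%:E * \int[mu]_t (G (x, t))%:E))%E.
  apply: eq_integral => x _.
  have E := ge0_integral_affine (a * x) b0 (mGx x) (fun t => GE0 (x, t)).
  rewrite -{}E; apply: eq_integral => y _.
  by rewrite /G/= addrK [b * y + _]addrC (_ : b * y / b = y)//; field.
rewrite ge0_integralZl//=; first last.
- by move=> x _; apply: integral_ge0 => y _; rewrite lee_fin.
- exact: (measurable_fun_fubini_tonelli_F (m2 := mu) _ mGE GE0).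
rewrite (fubini_tonelli (m1 := mu) (m2 := mu) _ mGE GE0)/=.
have inner t : (\int[mu]_x (G (x, t))%:E = (`|b| / c)%:E * (psi t * gauss (t / c))%:E)%E.
  rewrite /G/=.
  under eq_integral => x _ do rewrite (gauss_mul _ _ b0 c0 c2) mulrA EFinM.
  rewrite ge0_integralZl//=; first last.
  - by rewrite lee_fin mulr_ge0 ?gauss_ge0.
  - by move=> x _; rewrite lee_fin gauss_ge0.
  - apply/measurable_EFinP; apply: measurableT_comp => //.
    by apply: measurable_funB => //; apply: measurable_funM.
  rewrite muleC; congr (_ * _)%E.
  have /= -> := @ge0_integral_affine R (EFin \o gauss) (c / b) (- (a * t / (b * c))).
  - by rewrite integral_gauss mule1 normrM normfV invfM invrK (gtr0_norm cp) mulrC.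
  - by rewrite mulf_neq0 ?invr_neq0.
  - exact/measurable_EFinP.
  - by move=> x; rewrite lee_fin gauss_ge0.
under eq_integral => t _ do rewrite inner.
have mH : measurable_fun setT (fun t => (psi t * gauss (t / c))%:E).
  apply/measurable_EFinP; apply: measurable_funM => //.
  by apply: measurableT_comp => //; apply: measurable_funM.
have H0 t : (0 <= (psi t * gauss (t / c))%:E)%E by rewrite lee_fin mulr_ge0 ?gauss_ge0.
rewrite ge0_integralZl//; last by rewrite lee_fin divr_ge0// ltW.
rewrite muleA -EFinM mulrA mulVf ?normr_eq0// mul1r.
have := @ge0_integral_affine R (fun t => (psi t * gauss (t / c))%:E) c 0 c0 mH H0.
rewrite gtr0_norm// => <-.
apply: eq_integral => t _; rewrite addr0 (_ : c * t / c = t)//; by field.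
Qed.

End GaussianProjection.

(** * Vectors and the Maxwellian *)

Section Vectors.
Context {R : realType}.
Implicit Types x y z u k : 'cV[R]_3.

Lemma dotE x y :
  dot x y = x 0 0 * y 0 0 + x 1 0 * y 1 0 + x 2%R 0 * y 2%R 0.
Proof.
rewrite /dot !big_ord_recl big_ord0 addr0 addrA.
by congr (_ + _ * _ + _ * _); congr (_ _ 0); apply: val_inj.
Qed.

Lemma vec3E (p : R * R * R) :
  (vec3 p 0 0 = p.1.1) * (vec3 p 1 0 = p.1.2) * (vec3 p 2%R 0 = p.2).
Proof. by rewrite /vec3 !mxE. Qed.

Lemma dotC x y : dot x y = dot y x.
Proof. by rewrite !dotE; ring. Qed.

Lemma dotDl x y z : dot (x + y) z = dot x z + dot y z.
Proof. by rewrite !dotE !mxE; ring. Qed.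

Lemma dotZl (c : R) x y : dot (c *: x) y = c * dot x y.
Proof. by rewrite !dotE !mxE; ring. Qed.

Lemma dotZr (c : R) x y : dot x (c *: y) = c * dot x y.
Proof. by rewrite !dotE !mxE; ring. Qed.

Lemma dotBr x y z : dot x (y - z) = dot x y - dot x z.
Proof. by rewrite !dotE !mxE; ring. Qed.

Lemma dot_ge0 x : 0 <= dot x x.
Proof. by rewrite dotE !addr_ge0// -expr2 sqr_ge0. Qed.

Lemma enorm_ge0 x : 0 <= enorm x.
Proof. exact: sqrtr_ge0. Qed.

Lemma enorm_sqr x : enorm x ^+ 2 = dot x x.
Proof. by rewrite sqr_sqrtr// dot_ge0. Qed.

Lemma enorm_eq0 x : enorm x = 0 -> x = 0.
Proof.
move=> /(congr1 (fun r => r ^+ 2)); rewrite enorm_sqr expr0n/= dotE -!expr2.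
move/eqP; rewrite !paddr_eq0 ?addr_ge0 ?sqr_ge0// !sqrf_eq0.
move=> /andP[/andP[/eqP h0 /eqP h1] /eqP h2].
apply/matrixP => i j; rewrite ord1 mxE.
case: i => -[|[|[|//]]] hi.
- by rewrite -h0; congr (x _ _); apply: val_inj.
- by rewrite -h1; congr (x _ _); apply: val_inj.
- by rewrite -h2; congr (x _ _); apply: val_inj.
Qed.

Lemma enorm_gt0 x : x <> 0 -> 0 < enorm x.
Proof.
by move=> x0; rewrite lt_def enorm_ge0 andbT; apply/eqP => /enorm_eq0.
Qed.

End Vectors.

Section ProductSigmaFinite.
Context d1 d2 (T1 : measurableType d1) (T2 : measurableType d2) (R : realType).
Variable m1 : {sigma_finite_measure set T1 -> \bar R}.
Variable m2 : {sigma_finite_measure set T2 -> \bar R}.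

(** Tonelli for the triple product needs its first factor, itself a product, to
    be sigma-finite. *)
Lemma sigma_finite_product : sigma_finite setT (m1 \x m2)%E.
Proof.
have /sigma_finiteP[F [TF ndF Foo]] := sigma_finiteT m1.
have /sigma_finiteP[G [TG ndG Goo]] := sigma_finiteT m2.
exists (fun n => F n `*` G n).
  apply/seteqP; split=> // -[x y] _.
  have [n _ Fnx] : (\bigcup_n F n) x by rewrite -TF.
  have [k _ Gky] : (\bigcup_n G n) y by rewrite -TG.
  exists (maxn n k) => //; split.
    by move: x Fnx; exact/subsetPset/ndF/leq_maxl.
  by move: y Gky; exact/subsetPset/ndG/leq_maxr.
move=> k; have [mF Fk] := Foo k; have [mG Gk] := Goo k.
split; first exact: measurableX.
by rewrite product_measure1E// lte_mul_pinfty// ge0_fin_numE.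
Qed.

End ProductSigmaFinite.

Section Maxwellian.
Context {R : realType}.
Local Notation mu := (@lebesgue_measure R).
Local Notation maxwellian := (@maxwellian R).

Lemma maxwellian_vec3 (p : R * R * R) :
  maxwellian (vec3 p) = gauss p.1.1 * gauss p.1.2 * gauss p.2.
Proof.
rewrite /maxwellian enorm_sqr dotE !vec3E /gauss.
have pi2 : 0 <= 2 * pi :> R by rewrite mulr_ge0// pi_ge0.
have -> : (2 * pi : R) `^ (- (3 / 2)) = (Num.sqrt (2 * pi))^-1 ^+ 3.
  rewrite powRN (_ : 3 / 2 = 2^-1 * 3); last by rewrite mulrC.
  by rewrite powRrM powR12_sqrt// powR_mulrn ?sqrtr_ge0// exprVn.
set s := _^-1.
rewrite [RHS](_ : _ = s ^+ 3 * (expR (- (p.1.1 ^+ 2 / 2)) *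
  expR (- (p.1.2 ^+ 2 / 2)) * expR (- (p.2 ^+ 2 / 2)))); last by ring.
by rewrite -!expRD; congr (_ * expR _); field.
Qed.

Lemma grad_maxwellian u : grad maxwellian u = - maxwellian u *: u.
Proof.
apply/matrixP => i j; rewrite ord1 !mxE.
have E : (fun h : R => maxwellian (h *: delta_mx i 0 + u)) =
  (fun h => maxwellian u * expR (- (h ^+ 2 / 2 + h * u i 0))).
  apply/funext => h; rewrite /maxwellian !enorm_sqr -mulrA -expRD.
  congr (_ * expR _).
  have d1 x : dot (delta_mx i 0) x = x i 0 :> R.
    rewrite /dot (bigD1 i)//= mxE !eqxx mul1r big1 ?addr0// => l li.
    by rewrite mxE (negbTE li) mul0r.
  rewrite dotDl dotZl d1 [dot u (_ + _)]dotC dotDl dotZl d1 !mxE !eqxx/=.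
  by field.
have dE : is_derive (0 : R) 1
    (fun h => maxwellian u * expR (- (h ^+ 2 / 2 + h * u i 0)))
    (- maxwellian u * u i 0).
  apply: is_derive_eq.
  rewrite /GRing.scale/= expr0n/= !(mul0r, mulr0, mulr1, addr0, add0r, oppr0, expR0).
  by rewrite mul1r mulNr mulrN.
rewrite -[RHS](@derive_val _ _ _ _ _ _ _ dE) -derive1E -E /derive /derive1.
suff -> : (fun h : R => h^-1 *: ((maxwellian \o shift u) (h *: delta_mx i 0) - maxwellian u)) =
  (fun h : R => h^-1 *: (maxwellian ((h + 0) *: delta_mx i 0 + u) -
     maxwellian (0 *: delta_mx i 0 + u))) by [].
by apply/funext => h; rewrite /= addr0 scale0r add0r.
Qed.

(** Two plane projections in succession: first the first two coordinates, then
    the resulting Gaussian variable with the third one. *)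
Lemma integral_projected_maxwellian (psi : R -> R) (k : 'cV[R]_3) :
  measurable_fun setT psi -> (forall x, 0 <= psi x) ->
  (\int[(mu \x mu \x mu)%E]_p (psi (dot k (vec3 p)) * maxwellian (vec3 p))%:E =
   \int[mu]_t (psi (enorm k * t) * gauss t)%:E)%E.
Proof.
move=> mpsi psi0; have mg := @measurable_gauss R.
pose F (p : measurableTypeR R * measurableTypeR R * measurableTypeR R) : R :=
  psi (k 0 0 * p.1.1 + k 1 0 * p.1.2 + k 2%R 0 * p.2) *
  (gauss p.1.1 * gauss p.1.2 * gauss p.2).
have m1 : measurable_fun setT
    (fun p : measurableTypeR R * measurableTypeR R * measurableTypeR R => p.1.1).
  exact: measurableT_comp.
have m2 : measurable_fun setT
    (fun p : measurableTypeR R * measurableTypeR R * measurableTypeR R => p.1.2).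
  exact: measurableT_comp.
have mF : measurable_fun setT (EFin \o F).
  apply/measurable_EFinP; apply: measurable_funM.
    apply: measurableT_comp => //; apply: measurable_funD; last exact: measurable_funM.
    by apply: measurable_funD; apply: measurable_funM.
  apply: measurable_funM; last exact: measurableT_comp.
  by apply: measurable_funM; apply: measurableT_comp.
have F0 p : (0 <= (EFin \o F) p)%E by rewrite lee_fin !mulr_ge0 ?gauss_ge0.
rewrite (eq_integral (EFin \o F)); last first.
  by move=> p _; rewrite /= maxwellian_vec3 dotE !vec3E.
pose mm : {sigma_finite_measure set (measurableTypeR R * measurableTypeR R)%type -> \bar R} :=
  HB.pack (mu \x mu)%E (Measure_isSigmaFinite.Build _ _ _ (mu \x mu)%E
    (sigma_finite_product mu mu)).
have E3 := fubini_tonelli2 (m1 := mm) (m2 := mu) _ mF F0.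
etransitivity; first exact: E3.
move=> {E3}.
set c := Num.sqrt (k 0 0 ^+ 2 + k 1 0 ^+ 2).
transitivity (\int[mu]_z \int[mu]_t (psi (k 2%R 0 * z + c * t) * (gauss z * gauss t))%:E)%E.
  apply: eq_integral => z _; rewrite /fubini_G/=.
  pose psiz w := psi (k 2%R 0 * z + w) * gauss z.
  have mpsiz : measurable_fun setT psiz.
    apply: measurable_funM => //; apply: measurableT_comp => //.
    exact: measurable_funD.
  have psiz0 w : 0 <= psiz w by rewrite mulr_ge0 ?gauss_ge0.
  have := gauss_proj2 (k 0 0) (k 1 0) mpsiz psiz0.
  rewrite -/c => E.
  transitivity (\int[mu]_t (psiz (c * t) * gauss t)%:E)%E; last first.
    by apply: eq_integral => t _; rewrite /psiz mulrA.
  rewrite -E.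
  rewrite (fubini_tonelli1 (m1 := mu) (m2 := mu)).
  - apply: eq_integral => x _; apply: eq_integral => y _ /=.
    rewrite /F/psiz/=; congr (_%:E); rewrite [k 2%R 0 * z + _]addrC; ring.
  - apply: (measurableT_comp mF); exact: measurable_pair2.
  - by move=> p; exact: F0.
rewrite gauss_proj2// sqr_sqrtr ?addr_ge0 ?sqr_ge0//.
apply: eq_integral => t _; congr (psi (_ * _) * _)%:E.
by rewrite /enorm dotE -!expr2 addrC.
Qed.

End Maxwellian.

(** * The Dawson integral *)

Section DawsonIntegral.
Context {R : realType}.
Local Notation mu := (@lebesgue_measure R).

Definition exp_sqr_int (y : R) : R := \int[mu]_(t in `[0, y]) expR (t ^+ 2 / 2).

(** For s <> 0 this is sinh(y s)/s, times gauss(s) exp(- y^2/2). *)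
Definition gauss_quotient (y s : R) : R := (gauss (s - y) - gauss (s + y)) / (2 * s).

Lemma gauss_shift (s t : R) :
  gauss (s + t) = expR (- (t ^+ 2 / 2)) * (gauss s * expR (- (t * s))).
Proof.
rewrite /gauss mulrCA -!mulrA -!expRD; congr (_ * expR _); by field.
Qed.

Lemma gauss_mulcosh (s t : R) : gauss s * ((expR (t * s) + expR (- (t * s))) / 2) =
  expR (t ^+ 2 / 2) * ((gauss (s - t) + gauss (s + t)) / 2).
Proof.
rewrite !gauss_shift sqrrN mulNr opprK.
have e1 : expR (t ^+ 2 / 2) * expR (- (t ^+ 2 / 2)) = 1 by rewrite -expRD subrr expR0.
rewrite -[LHS]mul1r -[X in X * _ = _]e1; ring.
Qed.

Lemma integral_gauss_shift (a : R) : (\int[mu]_s (gauss (s + a))%:E = 1)%E.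
Proof.
have mg : measurable_fun setT (EFin \o @gauss R).
  by apply/measurable_EFinP; exact: measurable_gauss.
have := @ge0_integral_affine R (EFin \o @gauss R) 1 a (oner_neq0 _) mg.
rewrite normr1 invr1 mul1e integral_gauss => <-.
  by apply: eq_integral => s _; rewrite /= mul1r.
by move=> x; rewrite lee_fin gauss_ge0.
Qed.

Lemma measurable_gauss_shift (a : R) : measurable_fun setT (fun s : R => gauss (s + a)).
Proof.
apply: (measurableT_comp (@measurable_gauss R)); exact: measurable_funD.
Qed.

Lemma integrable_gauss_shift (a : R) :
  mu.-integrable setT (fun s => (gauss (s + a))%:E).
Proof.
apply/integrableP; split.
  by apply/measurable_EFinP; exact: (measurable_gauss_shift a).
under eq_integral do rewrite /= ger0_norm ?gauss_ge0//.
by rewrite integral_gauss_shift ltry.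
Qed.

Lemma continuous_expR_sqr : continuous (fun t : R => expR (t ^+ 2 / 2)).
Proof. by apply: derivable_continuous => x; apply: ex_derive. Qed.

Lemma exp_sqr_int_fin (y : R) :
  (\int[mu]_(t in `[0%R, y]) (expR (t ^+ 2 / 2))%:E = (exp_sqr_int y)%:E)%E.
Proof.
rewrite /exp_sqr_int /Rintegral fineK//; apply: integrable_fin_num => //.
apply: continuous_compact_integrable; first exact: segment_compact.
exact/continuous_subspaceT/continuous_expR_sqr.
Qed.

(** This is sinh(y s)/s = int_0^y cosh(t s) dt, multiplied by a Gaussian; the
    factor s in the denominator of [gauss_quotient] is absorbed. *)
Lemma integral_cosh (y s : R) : 0 <= y -> s != 0 ->
  (\int[mu]_(t in `[0%R, y]) (expR (t ^+ 2 / 2) * ((gauss (s - t) + gauss (s + t)) / 2))%:E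
   = (expR (y ^+ 2 / 2) * gauss_quotient y s)%:E)%E.
Proof.
move=> y0 s0.
pose F t := gauss s * ((expR (t * s) - expR (- (t * s))) / (2 * s)).
pose f t := gauss s * ((expR (t * s) + expR (- (t * s))) / 2).
transitivity (\int[mu]_(t in `[0%R, y]) (f t)%:E)%E.
  by apply: eq_integral => t _; rewrite /f gauss_mulcosh.
have cf : continuous f by apply: derivable_continuous => x; apply: ex_derive.
have dF (x : R) : is_derive x 1 F (f x).
  by apply: is_derive_eq; rewrite /GRing.scale/= /f; field.
rewrite (integral_is_derive y0 cf dF).
rewrite /F mul0r oppr0 subrr mul0r mulr0 subr0 /gauss_quotient !gauss_shift sqrrN mulNr opprK.
have e1 : expR (y ^+ 2 / 2) * expR (- (y ^+ 2 / 2)) = 1 by rewrite -expRD subrr expR0.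
by congr (_%:E); rewrite -[LHS]mul1r -[X in X * _ = _]e1; ring.
Qed.

Lemma gauss_quotient_ge0 (y s : R) : 0 <= y -> 0 <= gauss_quotient y s.
Proof.
move=> y0.
have -> : gauss_quotient y s = expR (- (y ^+ 2 / 2)) * (gauss s *
    ((expR (y * s) - expR (- (y * s))) / (2 * s))).
  by rewrite /gauss_quotient !gauss_shift sqrrN mulNr opprK; ring.
rewrite mulr_ge0 ?expR_ge0// mulr_ge0 ?gauss_ge0//.
have [s0|s0] := leP 0 s.
  rewrite divr_ge0 ?mulr_ge0// subr_ge0 ler_expR.
  by have := mulr_ge0 y0 s0; lra.
rewrite -mulrNN -invrN mulr_ge0//.
  rewrite oppr_ge0 subr_le0 ler_expR.
  by have := mulr_ge0_le0 y0 (ltW s0); lra.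
by rewrite invr_ge0; lra.
Qed.

Lemma measurable_gauss_quotient (y : R) : measurable_fun setT (gauss_quotient y).
Proof.
apply: measurable_funM.
  by apply: measurable_funB; exact: measurable_gauss_shift.
by apply: measurable_funV; apply: measurable_funM.
Qed.

(** Exchanging the integral over s with the integral over t of
    [integral_cosh] leaves the total mass of shifted Gaussians, which is 1. *)
Lemma integral_gauss_quotient (y : R) : 0 <= y ->
  (\int[mu]_s (gauss_quotient y s)%:E = (expR (- (y ^+ 2 / 2)) * exp_sqr_int y)%:E)%E.
Proof.
move=> y0.
pose h (p : measurableTypeR R * measurableTypeR R) : R :=
  expR (p.2 ^+ 2 / 2) * ((gauss (p.1 - p.2) + gauss (p.1 + p.2)) / 2) * \1_`[0, y] p.2.
have mh : measurable_fun setT (EFin \o h).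
  apply/measurable_EFinP; apply: measurable_funM; last first.
    by apply: measurableT_comp => //; exact: measurable_indic.
  apply: measurable_funM.
    apply: measurableT_comp => //; apply: measurable_funM => //.
    exact: measurable_funX.
  apply: measurable_funM => //; apply: measurable_funD.
    by apply: (measurableT_comp (@measurable_gauss R)); apply: measurable_funB.
  by apply: (measurableT_comp (@measurable_gauss R)); apply: measurable_funD.
have h0 p : (0 <= (EFin \o h) p)%E.
  rewrite lee_fin mulr_ge0//.
  by rewrite mulr_ge0 ?expR_ge0// divr_ge0// addr_ge0 ?gauss_ge0.
have := fubini_tonelli (m1 := mu) (m2 := mu) _ mh h0.
have -> : (\int[mu]_t \int[mu]_s (EFin \o h) (s, t) = (exp_sqr_int y)%:E)%E.
  rewrite -exp_sqr_int_fin [RHS]integral_mkcond; apply: eq_integral => t _.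
  rewrite patchE/=.
  under eq_integral => s _ do rewrite /h/= mulrAC EFinM.
  have mgg : measurable_fun setT (fun s : R => ((gauss (s - t) + gauss (s + t)) / 2)%:E).
    apply/measurable_EFinP; apply: measurable_funM => //.
    by apply: measurable_funD; exact: measurable_gauss_shift.
  rewrite ge0_integralZl//; first last.
  - by move=> s _; rewrite lee_fin divr_ge0// addr_ge0 ?gauss_ge0.
  have mS a : measurable_fun setT (fun s : R => (gauss (s + a))%:E).
    by apply/measurable_EFinP; exact: (measurable_gauss_shift a).
  have S0 a (s : R) : setT s -> (0 <= (gauss (s + a))%:E)%E.
    by rewrite lee_fin gauss_ge0.
  have mS2 a : measurable_fun setT (fun s : R => (gauss (s + a) / 2)%:E).
    apply/measurable_EFinP; apply: measurable_funM => //.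
    exact: (measurable_gauss_shift a).
  have S02 a (s : R) : setT s -> (0 <= (gauss (s + a) / 2)%:E)%E.
    by rewrite lee_fin divr_ge0// gauss_ge0.
  under eq_integral => s _ do rewrite mulrDl EFinD.
  rewrite ge0_integralD//; try exact: mS2; try exact: S02.
  under eq_integral => s _ do rewrite EFinM.
  under [X in (_ + X)%E]eq_integral => s _ do rewrite EFinM.
  rewrite !ge0_integralZr//; try exact: mS; try exact: S0.
  rewrite !integral_gauss_shift !mul1e -EFinD -EFinM indicE.
  have -> : 2^-1 + 2^-1 = 1 :> R by field.
  rewrite mulr1.
  by case: ifPn => _; rewrite /= ?mulr1 ?mulr0.
have -> : (\int[mu]_s \int[mu]_t (EFin \o h) (s, t) =
           (expR (y ^+ 2 / 2))%:E * \int[mu]_s (gauss_quotient y s)%:E)%E.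
  rewrite -ge0_integralZl//; first last.
  - by move=> s _; rewrite lee_fin gauss_quotient_ge0.
  - apply/measurable_EFinP; exact: measurable_gauss_quotient.
  apply: ae_eq_integral => //.
  - exact: (measurable_fun_fubini_tonelli_F (m2 := mu) _ mh h0).
  - by apply: measurable_funeM; apply/measurable_EFinP; exact: measurable_gauss_quotient.
  exists [set 0]; split; [by []|exact: lebesgue_measure_set1|].
  move=> s /= sP; apply: contrapT => /eqP s0; apply: sP => _.
  rewrite -[RHS]EFinM -integral_cosh// [RHS]integral_mkcond.
  apply: eq_integral => t _; rewrite patchE/= /h/= indicE.
  by case: ifPn => _; rewrite ?mulr1 ?mulr0.
move=> E; rewrite EFinM -{}E muleA -EFinM -expRD addNr expR0.
by rewrite mul1e.
Qed.

End DawsonIntegral.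

(** * Boundary values of the plasma integrals *)

Section PlasmaIntegrals.
Context {R : realType}.
Local Notation mu := (@lebesgue_measure R).

Lemma integrable_mulgauss (h : R -> R) (M : R) : measurable_fun setT h ->
  (forall t, `|h t| <= M) -> mu.-integrable setT (fun t => (h t * gauss t)%:E).
Proof.
move=> mh hM; have mg := @measurable_gauss R.
have ig : mu.-integrable setT (fun t => M%:E * (gauss t)%:E)%E.
  apply: integrableZl => //; apply: eq_integrable (integrable_gauss_shift 0) => //.
  by move=> t _; rewrite addr0.
apply: le_integrable ig => //.
  by apply/measurable_EFinP; exact: measurable_funM.
move=> t _; rewrite -EFinM !abse_EFin lee_fin !normrM ler_wpM2r//.
exact: (le_trans (hM t) (ler_norm _)).
Qed.

(** The real and imaginary parts of the regularized integral of
    t gauss(t) / (t - y + i eta) over the line. *)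
Definition plasmaRe (eta y : R) : R :=
  \int[mu]_t (t * (t - y) / ((t - y) ^+ 2 + eta ^+ 2) * gauss t).

Definition plasmaIm (eta y : R) : R :=
  \int[mu]_t (- t * eta / ((t - y) ^+ 2 + eta ^+ 2) * gauss t).

(** The real and imaginary parts of the limit as eta decreases to 0.  The
    absolute values make the evenness of PsiR apparent; the integral of
    exp(t^2/2) is zero on intervals with negative right end. *)
Definition PsiR (y : R) : R :=
  1 - `|y| * (expR (- (y ^+ 2 / 2)) * exp_sqr_int `|y|).

Definition PsiI (y : R) : R := - (pi * (y * gauss y)).

Lemma measurable_funD1sqr (c : R) (f : R -> R) : measurable_fun setT f ->
  measurable_fun setT (fun t => f t ^+ 2 + c).
Proof. by move=> mf; apply: measurable_funD => //; exact: measurable_funX. Qed.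

Let den_gt0 (eta w : R) : 0 < eta -> 0 < w ^+ 2 + eta ^+ 2.
Proof. by move=> e0; rewrite ltr_wpDl ?sqr_ge0// exprn_gt0. Qed.

Lemma integrable_plasmaRe (eta y : R) : 0 < eta -> mu.-integrable setT
  (fun t => (t * (t - y) / ((t - y) ^+ 2 + eta ^+ 2) * gauss t)%:E).
Proof.
move=> e0; apply: (@integrable_mulgauss _ (1 + `|y| / eta)).
  apply: measurable_funM.
    by apply: measurable_funM => //; exact: measurable_funB.
  by apply: measurable_funV; apply: measurable_funD1sqr; exact: measurable_funB.
move=> t; set w := t - y; have dp := den_gt0 w e0.
have -> : t = w + y by rewrite /w subrK.
rewrite mulrDl mulrDl (le_trans (ler_normD _ _))// lerD//.
  rewrite -expr2 ger0_norm; last by rewrite divr_ge0 ?sqr_ge0// ltW.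
  by rewrite ler_pdivrMr// mul1r lerDl sqr_ge0.
rewrite -mulrA normrM ler_wpM2l// normf_div (gtr0_norm dp).
rewrite ler_pdivrMr// mulrC ler_pdivlMr// -(real_normK (num_real w)).
by have := sqr_ge0 (`|w| - eta); have := normr_ge0 w; nra.
Qed.

(** The integrand of the limit of [plasmaRe] after folding: with
    f(s) = (s + y) gauss(s + y) it is (f(s) - f(-s)) / (2 s) for s <> 0, which
    has no pole at 0, contrary to f(s)/s when y <> 0. *)
Definition plasma_core (y s : R) : R :=
  (gauss (s - y) + gauss (s + y)) / 2 - y * gauss_quotient y s.

(** Average the substitutions t = y + s and t = y - s: the odd kernel
    s/(s^2 + eta^2) turns f into its odd part. *)
Lemma plasmaRe_symm (eta y : R) : 0 < eta ->
  (\int[mu]_t (t * (t - y) / ((t - y) ^+ 2 + eta ^+ 2) * gauss t)%:E =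
   \int[mu]_s (plasma_core y s * (s ^+ 2 / (s ^+ 2 + eta ^+ 2)))%:E)%E.
Proof.
move=> e0; have iG := integrable_plasmaRe y e0.
pose G t := t * (t - y) / ((t - y) ^+ 2 + eta ^+ 2) * gauss t.
have n1 : -1 != 0 :> R by rewrite oppr_eq0 oner_neq0.
have iP := integrable_affine y (oner_neq0 R) iG.
have iN := integrable_affine y n1 iG.
have := integral_affine y (oner_neq0 R) iG.
have := integral_affine y n1 iG.
rewrite normrN normr1 invr1 mul1e => EN EP.
have fG : (\int[mu]_t (G t)%:E)%E \is a fin_num by exact: integrable_fin_num.
transitivity (\int[mu]_s ((2^-1)%:E * ((G (1 * s + y))%:E + (G (-1 * s + y))%:E)))%E.
  rewrite integralZl//; last exact: integrableD.
  rewrite integralD//= EN EP -(fineK fG) -EFinD -EFinM.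
  by congr (_%:E); field.
apply: eq_integral => s _; rewrite -EFinD -EFinM; congr (_%:E).
have ds := den_gt0 s e0.
rewrite /G mul1r mulN1r addrK [- s + y - y]addrK sqrrN.
rewrite [- s + y]addrC -[gauss (y - s)]gaussN opprB /plasma_core /gauss_quotient.
have [->|s0] := eqVneq s 0; first by rewrite !(expr0n, oppr0, mulr0, mul0r, addr0)/=; ring.
by field; rewrite s0 gt_eqF.
Qed.

Lemma integrable_gauss_quotient (y : R) : 0 <= y -> mu.-integrable setT (fun s => (gauss_quotient y s)%:E).
Proof.
move=> y0; apply/integrableP; split.
  by apply/measurable_EFinP; exact: (measurable_gauss_quotient y).
under eq_integral do rewrite abse_EFin ger0_norm ?gauss_quotient_ge0//.
by rewrite integral_gauss_quotient// ltry.
Qed.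

Lemma integrable_plasma_core (c y : R) : 0 <= y -> mu.-integrable setT
  (fun s => ((gauss (s - y) + gauss (s + y)) / 2 + c * gauss_quotient y s)%:E).
Proof.
move=> y0.
have -> : (fun s => ((gauss (s - y) + gauss (s + y)) / 2 + c * gauss_quotient y s)%:E) =
  (fun s : R => (2^-1)%:E * ((gauss (s - y))%:E + (gauss (s + y))%:E) + c%:E * (gauss_quotient y s)%:E)%E.
  by apply/funext => s; rewrite [_ / 2]mulrC EFinD EFinM EFinD EFinM.
apply: integrableD => //; last by apply: integrableZl => //; exact: integrable_gauss_quotient.
by apply: integrableZl => //; apply: integrableD => //; exact: integrable_gauss_shift.
Qed.

Lemma integral_plasma_core (y : R) : 0 <= y ->
  (\int[mu]_s (plasma_core y s)%:E = (PsiR y)%:E)%E.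
Proof.
move=> y0.
transitivity (\int[mu]_s ((2^-1)%:E * ((gauss (s - y))%:E + (gauss (s + y))%:E) + (- y)%:E * (gauss_quotient y s)%:E))%E.
  apply: eq_integral => s _; rewrite /plasma_core -mulNr.
  by rewrite [_ / 2]mulrC EFinD EFinM EFinD EFinM.
have i1 := integrable_gauss_shift (- y); have i2 := integrable_gauss_shift y.
have i3 : mu.-integrable setT (fun s => (gauss (s - y))%:E + (gauss (s + y))%:E)%E by exact: integrableD.
have i4 := integrable_gauss_quotient y0.
rewrite integralD//; [|exact: integrableZl|exact: integrableZl].
rewrite integralZl// integralZl// integralD// !integral_gauss_shift integral_gauss_quotient//.
transitivity ((2^-1 * (1 + 1) + - y * (expR (- (y ^+ 2 / 2)) * exp_sqr_int y))%:E).
  by rewrite EFinD !EFinM EFinD.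
by rewrite /PsiR ger0_norm//; congr (_%:E); field.
Qed.

(** Dominated convergence.  For y >= 0 the quotient is nonnegative, so that the
    two terms of [plasma_core], taken with a plus sign, dominate. *)
Lemma cvg_plasmaRe_ge0 (y : R) : 0 <= y ->
  plasmaRe eta y @[eta --> 0^'+] --> PsiR y.
Proof.
move=> y0; apply/cvg_at_rightP => u [u0 ucvg].
have mcore : measurable_fun setT (plasma_core y).
  apply: measurable_funB; last by apply: measurable_funM => //; exact: (measurable_gauss_quotient y).
  apply: measurable_funM => //; apply: measurable_funD.
    exact: (measurable_gauss_shift (- y)).
  exact: (measurable_gauss_shift y).
pose f n s : \bar R := (plasma_core y s * (s ^+ 2 / (s ^+ 2 + u n ^+ 2)))%:E.
pose g s : \bar R := ((gauss (s - y) + gauss (s + y)) / 2 + y * gauss_quotient y s)%:E.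
suff E : (\int[mu]_s f n s)%E @[n --> \oo] --> (PsiR y)%:E.
  have -> : (fun n => plasmaRe (u n) y) = fine \o (fun n => \int[mu]_s f n s)%E.
    by apply/funext => n; rewrite /= /plasmaRe /Rintegral plasmaRe_symm.
  exact: fine_cvg.
rewrite -integral_plasma_core//.
have := @dominated_convergence _ _ _ mu setT measurableT f (EFin \o plasma_core y) g.
case.
- move=> n; apply/measurable_EFinP; apply: measurable_funM => //.
  apply: measurable_funM; first exact: measurable_funX.
  by apply: measurable_funV; exact: measurable_funD1sqr.
- exact/measurable_EFinP.
- exists [set 0]; split; [by []|exact: lebesgue_measure_set1|].
  move=> s /= sP; apply: contrapT => /eqP s0; apply: sP => _.
  apply: cvg_EFin; first exact: nearW.
  rewrite /= /f /=.
  rewrite -[X in _ --> X]mulr1; apply: cvgMl_tmp.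
  rewrite -[X in _ --> X](@divff _ (s ^+ 2)) ?sqrf_eq0//.
  apply: cvgMl_tmp; apply: cvgV; first by rewrite sqrf_eq0.
  rewrite -[X in _ --> X]addr0; apply: cvgD; first exact: cvg_cst.
  by rewrite -[X in _ --> X](mulr0 (0 : R)); exact: cvgM.
- exact: integrable_plasma_core.
- apply: aeW => s n _.
  rewrite /f /g abse_EFin lee_fin normrM.
  have ds := den_gt0 s (u0 n).
  rewrite -[leRHS]mulr1 ler_pM//.
    rewrite /plasma_core (le_trans (ler_normB _ _))// lerD//.
      by rewrite ger0_norm// divr_ge0// addr_ge0// gauss_ge0.
    by rewrite ger0_norm// mulr_ge0// gauss_quotient_ge0.
  rewrite ger0_norm; last by rewrite divr_ge0 ?sqr_ge0// ltW.
  by rewrite ler_pdivrMr// mul1r lerDl sqr_ge0.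
- by move=> _ _; apply.
Qed.

Lemma plasmaReN (eta y : R) : 0 < eta -> plasmaRe eta (- y) = plasmaRe eta y.
Proof.
move=> e0; have n1 : -1 != 0 :> R by rewrite oppr_eq0 oner_neq0.
have := Rintegral_affine 0 n1 (integrable_plasmaRe y e0).
rewrite normrN normr1 invr1 mul1r /plasmaRe => <-.
by apply: eq_Rintegral => t _; rewrite addr0 mulN1r gaussN -opprD sqrrN opprK mulrNN.
Qed.

Lemma cvg_plasmaRe (y : R) : plasmaRe eta y @[eta --> 0^'+] --> PsiR y.
Proof.
have [y0|y0] := leP 0 y; first exact: cvg_plasmaRe_ge0.
have := @cvg_plasmaRe_ge0 (- y); rewrite oppr_ge0 => /(_ (ltW y0)).
have -> : PsiR (- y) = PsiR y by rewrite /PsiR normrN sqrrN.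
apply: cvg_trans; apply: near_eq_cvg; near=> e.
by rewrite plasmaReN.
Unshelve. all: by end_near. Qed.

Lemma integral_oneDsqr : (\int[mu]_t ((1 + t ^+ 2)^-1)%:E = pi%:E)%E.
Proof.
rewrite (ge0_symfun_integralT (f := fun t : R => (1 + t ^+ 2)^-1)).
- have := @integral0y_oneDsqr R; rewrite set_itvcy => ->.
  by rewrite -EFinM; congr (_%:E); field.
- by move=> t; rewrite invr_ge0 addr_ge0// sqr_ge0.
- exact: (@continuous_oneDsqrV R).
- by move=> t; rewrite /= sqrrN.
Qed.

Lemma integrable_oneDsqr (c : R) :
  mu.-integrable setT (fun t => (c * (1 + t ^+ 2)^-1)%:E).
Proof.
have mi : measurable_fun setT (fun t : R => (1 + t ^+ 2)^-1).
  apply: measurable_funV; apply: measurable_funD => //; exact: measurable_funX.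
have -> : (fun t => (c * (1 + t ^+ 2)^-1)%:E) = (fun t : R => c%:E * ((1 + t ^+ 2)^-1)%:E)%E.
  by apply/funext => t; rewrite EFinM.
apply: integrableZl => //; apply/integrableP; split; first exact/measurable_EFinP.
under eq_integral => t _.
  rewrite abse_EFin ger0_norm; last by rewrite invr_ge0 addr_ge0// sqr_ge0.
  over.
by rewrite integral_oneDsqr ltry.
Qed.

Lemma continuous_gauss : continuous (@gauss R).
Proof. by rewrite gauss_normal_pdf; exact: continuous_normal_pdf. Qed.

Lemma mulgauss_le1 (t : R) : `|t * gauss t| <= 1.
Proof.
rewrite normrM (ger0_norm (gauss_ge0 _)).
have t1 : `|t| <= expR (t ^+ 2 / 2).
  apply: (le_trans _ (expR_ge1Dx _)); rewrite -(real_normK (num_real t)).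
  by have := sqr_ge0 (`|t| - 1); nra.
have s1 : 1 <= Num.sqrt (2 * pi) :> R.
  rewrite -[leLHS]sqrtr1 ler_sqrt ?mulr_ge0 ?pi_ge0//.
  by have := pi_ge2 R; lra.
rewrite /gauss expRN mulrCA -[leRHS]mulr1 ler_pM ?invr_ge0 ?mulr_ge0 ?invr_ge0 ?expR_ge0//.
  by rewrite invf_le1// (lt_le_trans ltr01).
by rewrite ler_pdivrMr ?expR_gt0// mul1r.
Qed.

Lemma integrable_plasmaIm (eta y : R) : 0 < eta -> mu.-integrable setT
  (fun t => (- t * eta / ((t - y) ^+ 2 + eta ^+ 2) * gauss t)%:E).
Proof.
move=> e0; apply: (@integrable_mulgauss _ (1 + `|y| / eta)).
  apply: measurable_funM; first by apply: measurable_funM => //; exact: measurable_funN.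
  by apply: measurable_funV; apply: measurable_funD1sqr; exact: measurable_funB.
move=> t; set w := t - y; have dp := den_gt0 w e0.
have -> : t = w + y by rewrite /w subrK.
rewrite mulNr mulNr normrN normf_div (gtr0_norm dp) normrM (gtr0_norm e0).
rewrite ler_pdivrMr//.
have h1 : `|w| * eta <= w ^+ 2 + eta ^+ 2.
  rewrite -(real_normK (num_real w)).
  by have := sqr_ge0 (`|w| - eta); have := normr_ge0 w; nra.
have h2 : `|y| * eta <= `|y| / eta * (w ^+ 2 + eta ^+ 2).
  rewrite -mulrA ler_wpM2l// ler_pdivlMl// -expr2 lerDr sqr_ge0//.
apply: (le_trans (ler_wpM2r (ltW e0) (ler_normD w y))); lra.
Qed.

(** Rescaling around the pole at the scale eta turns the Poisson kernel into the
    fixed density 1/(1 + s^2). *)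
Lemma plasmaIm_shift (eta y : R) : 0 < eta ->
  plasmaIm eta y = \int[mu]_s (- ((eta * s + y) * gauss (eta * s + y)) * (1 + s ^+ 2)^-1).
Proof.
move=> e0; have en : eta != 0 by rewrite gt_eqF.
have iG := integrable_plasmaIm y e0.
have := Rintegral_affine y en iG.
rewrite (gtr0_norm e0) => /(congr1 ( *%R eta)); rewrite mulrA divff// mul1r.
rewrite /plasmaIm => <-; rewrite -RintegralZl//; last exact: (integrable_affine y en iG).
apply: eq_Rintegral => s _; rewrite addrK.
have sp : 1 + s ^+ 2 != 0 by rewrite gt_eqF// ltr_wpDr ?sqr_ge0.
have -> : (eta * s) ^+ 2 + eta ^+ 2 = eta ^+ 2 * (1 + s ^+ 2) by ring.
by field; rewrite en sp.
Qed.

Lemma cvg_plasmaIm (y : R) : plasmaIm eta y @[eta --> 0^'+] --> PsiI y.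
Proof.
apply/cvg_at_rightP => u [u0 ucvg].
pose k (x : R) := - (x * gauss x).
have ck : continuous k.
  move=> x; apply: cvgN; apply: cvgM; first exact: cvg_id.
  exact: continuous_gauss.
have mk : measurable_fun setT k by exact: continuous_measurable_fun.
have mi : measurable_fun setT (fun t : R => (1 + t ^+ 2)^-1).
  by apply: measurable_funV; apply: measurable_funD => //; exact: measurable_funX.
pose f n s : \bar R := (k (u n * s + y) * (1 + s ^+ 2)^-1)%:E.
pose f0 (s : R) : \bar R := (k y * (1 + s ^+ 2)^-1)%:E.
pose g (s : R) : \bar R := (1 * (1 + s ^+ 2)^-1)%:E.
have Ef0 : (\int[mu]_s f0 s = (PsiI y)%:E)%E.
  rewrite /f0; under eq_integral do rewrite EFinM.
  rewrite integralZl//; last first.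
    apply: eq_integrable (integrable_oneDsqr 1) => //.
    by move=> t _; rewrite mul1r.
  by rewrite integral_oneDsqr -EFinM /PsiI /k mulNr mulrC.
suff E : (\int[mu]_s f n s)%E @[n --> \oo] --> (PsiI y)%:E.
  have -> : (fun n => plasmaIm (u n) y) = fine \o (fun n => \int[mu]_s f n s)%E.
    by apply/funext => n; rewrite /= plasmaIm_shift.
  exact: fine_cvg.
rewrite -Ef0.
have := @dominated_convergence _ _ _ mu setT measurableT f f0 g.
case.
- move=> n; apply/measurable_EFinP; apply: measurable_funM => //.
  exact: (measurableT_comp mk (@measurable_affine R (u n) y)).
- by apply/measurable_EFinP; exact: measurable_funM.
- apply: aeW => s _; apply: cvg_EFin; first exact: nearW.
  have us : u n * s + y @[n --> \oo] --> y.
    rewrite -[X in _ --> X]add0r; apply: cvgD; last exact: cvg_cst.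
    by rewrite -[X in _ --> X](mul0r s); apply: cvgMr_tmp.
  by rewrite /f/=; apply: cvgMr_tmp; apply: (cvg_comp _ _ us); exact: ck.
- exact: integrable_oneDsqr.
- apply: aeW => s n _; rewrite /f /g abse_EFin lee_fin normrM.
  have sp : 0 <= (1 + s ^+ 2)^-1 by rewrite invr_ge0 addr_ge0// sqr_ge0.
  by rewrite (ger0_norm sp) ler_wpM2r// /k normrN mulgauss_le1.
- by move=> _ _; apply.
Qed.

End PlasmaIntegrals.

(** * The dispersion function at the Maxwellian *)

Section Dispersion.
Context {R : realType}.
Local Notation mu := (@lebesgue_measure R).
Local Notation maxwellian := (@maxwellian R).
Local Open Scope complex_scope.

(** The signed version: the positive and the negative part are transported
    separately, as extended reals. *)
Lemma Rintegral_projected_maxwellian (phi : R -> R) (k : 'cV[R]_3) :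
  measurable_fun setT phi ->
  \int[(mu \x mu \x mu)%E]_p (phi (dot k (vec3 p)) * maxwellian (vec3 p)) =
  \int[mu]_t (phi (enorm k * t) * gauss t).
Proof.
move=> mphi; rewrite /Rintegral; congr fine.
have M0 p : 0 <= maxwellian (vec3 p) by rewrite maxwellian_vec3 !mulr_ge0 ?gauss_ge0.
have maxM (a m : R) : 0 <= m -> (maxe (a * m)%:E 0 = (Num.max a 0 * m)%:E)%E.
  by move=> m0; rewrite -EFin_max maxr_pMl// mul0r.
rewrite integralE [in RHS]integralE.
congr (_ - _)%E.
- transitivity (\int[(mu \x mu \x mu)%E]_p
    ((Num.max (phi (dot k (vec3 p))) 0) * maxwellian (vec3 p))%:E)%E.
    by apply: eq_integral => p _; rewrite funeposE maxM.
  rewrite (@integral_projected_maxwellian _ (fun s => Num.max (phi s) 0))//.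
  + by apply: eq_integral => t _; rewrite funeposE maxM// gauss_ge0.
  + exact: measurable_maxr.
  + by move=> x; rewrite le_max lexx orbT.
- transitivity (\int[(mu \x mu \x mu)%E]_p
    ((Num.max (- phi (dot k (vec3 p))) 0) * maxwellian (vec3 p))%:E)%E.
    by apply: eq_integral => p _; rewrite funenegE -EFinN -mulNr maxM.
  rewrite (@integral_projected_maxwellian _ (fun s => Num.max (- phi s) 0))//.
  + by apply: eq_integral => t _; rewrite funenegE -EFinN -mulNr maxM// gauss_ge0.
  + by apply: measurable_maxr => //; exact: measurable_funN.
  + by move=> x; rewrite le_max lexx orbT.
Qed.

Lemma complex_div_real (a w h : R) : a%:C / (w -i* h) =
  (a * w / (w ^+ 2 + h ^+ 2)) +i* (a * h / (w ^+ 2 + h ^+ 2)).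
Proof.
change ((a * (w / (w ^+ 2 + (- h) ^+ 2)) - 0 * - (- h / (w ^+ 2 + (- h) ^+ 2))) +i*
  (a * - (- h / (w ^+ 2 + (- h) ^+ 2)) + 0 * (w / (w ^+ 2 + (- h) ^+ 2))) =
  (a * w / (w ^+ 2 + h ^+ 2)) +i* (a * h / (w ^+ 2 + h ^+ 2))).
by rewrite sqrrN; congr (_ +i* _); ring.
Qed.

Section DispersionLimit.
Variables (k v : 'cV[R]_3).
Hypothesis k0 : k <> 0.

Let kappa := enorm k.
Let y := dot k v / kappa.
Let kappa_gt0 : 0 < kappa := enorm_gt0 k0.

Let integrandE (h : R) (p : R * R * R) : 
  (dot k (grad maxwellian (vec3 p)))%:C / (dot k (v - vec3 p) -i* h) =
  (- dot k (vec3 p) * (dot k v - dot k (vec3 p)) /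
     ((dot k v - dot k (vec3 p)) ^+ 2 + h ^+ 2) * maxwellian (vec3 p)) +i*
  (- dot k (vec3 p) * h /
     ((dot k v - dot k (vec3 p)) ^+ 2 + h ^+ 2) * maxwellian (vec3 p)).
Proof.
rewrite complex_div_real grad_maxwellian dotZr dotBr.
by congr (_ +i* _); ring.
Qed.

Let mden (h : R) : measurable_fun setT (fun s : R => ((dot k v - s) ^+ 2 + h ^+ 2)^-1).
Proof.
apply: measurable_funV; apply: measurable_funD1sqr.
exact: measurable_funB.
Qed.

Let kvE : dot k v = kappa * y.
Proof. by rewrite /y mulrC divfK// gt_eqF. Qed.

Let den_gt0 (eta w : R) : 0 < eta -> w ^+ 2 + eta ^+ 2 != 0.
Proof. by move=> e0; rewrite gt_eqF// ltr_wpDl ?sqr_ge0// exprn_gt0. Qed.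

Let re_integral (h : R) : 0 < h ->
  \int[(mu \x mu \x mu)%E]_p complex.Re
    ((dot k (grad maxwellian (vec3 p)))%:C / (dot k (v - vec3 p) -i* h)) =
  plasmaRe (h / kappa) y.
Proof.
move=> h0; under eq_Rintegral do rewrite integrandE/=.
have -> := @Rintegral_projected_maxwellian
  (fun s => - s * (dot k v - s) / ((dot k v - s) ^+ 2 + h ^+ 2)) k.
  apply: eq_Rintegral => t _; rewrite -/kappa kvE -mulrBr; congr (_ * _).
  have hk0 : 0 < h / kappa by rewrite divr_gt0.
  have := den_gt0 (t - y) hk0; have kn : kappa != 0 by rewrite gt_eqF.
  have -> : (kappa * (y - t)) ^+ 2 + h ^+ 2 = kappa ^+ 2 * ((t - y) ^+ 2 + (h / kappa) ^+ 2).
    by field.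
  by move: (_ ^+ 2 + _) => D dn; field; rewrite dn kn.
apply: measurable_funM => //; apply: measurable_funM; first exact: measurable_funN.
exact: measurable_funB.
Qed.

Let im_integral (h : R) : 0 < h ->
  \int[(mu \x mu \x mu)%E]_p complex.Im
    ((dot k (grad maxwellian (vec3 p)))%:C / (dot k (v - vec3 p) -i* h)) =
  plasmaIm (h / kappa) y.
Proof.
move=> h0; under eq_Rintegral do rewrite integrandE/=.
have -> := @Rintegral_projected_maxwellian
  (fun s => - s * h / ((dot k v - s) ^+ 2 + h ^+ 2)) k.
  apply: eq_Rintegral => t _; rewrite -/kappa kvE -mulrBr; congr (_ * _).
  have hk0 : 0 < h / kappa by rewrite divr_gt0.
  have := den_gt0 (t - y) hk0; have kn : kappa != 0 by rewrite gt_eqF.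
  have -> : (kappa * (y - t)) ^+ 2 + h ^+ 2 = kappa ^+ 2 * ((t - y) ^+ 2 + (h / kappa) ^+ 2).
    by field.
  by move: (_ ^+ 2 + _) => D dn; field; rewrite dn kn.
apply: measurable_funM => //; apply: measurable_funM => //; exact: measurable_funN.
Qed.

Let cvg_rescale (f g : R -> R) (l : R) : (forall h, 0 < h -> f h = g (h / kappa)) ->
  g h @[h --> 0^'+] --> l -> f h @[h --> 0^'+] --> l.
Proof.
move=> fg /cvg_at_rightP gl; apply/cvg_at_rightP => u [u0 uc].
have -> : (fun n => f (u n)) = (fun n => g (u n / kappa)).
  by apply/funext => n; exact: fg.
apply: gl; split; first by move=> n; rewrite divr_gt0.
by rewrite -[X in _ --> X](mul0r kappa^-1); exact: cvgMr_tmp.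
Qed.

(** Both parts of the regularized integral depend on h through h/|k| only, by
    homogeneity of the integrand. *)
Lemma dispersionE : dispersion k v =
  1 + (kappa ^- 2)%:C * (PsiR y +i* PsiI y).
Proof.
rewrite /dispersion /lim_right0C; congr (1 + _ * (_ +i* _)).
- apply: cvg_lim => //; exact: (cvg_rescale re_integral (@cvg_plasmaRe R y)).
- apply: cvg_lim => //; exact: (cvg_rescale im_integral (@cvg_plasmaIm R y)).
Qed.

(** In this form the singularity of the dispersion function at k = 0 cancels
    against the weight 1/|k|^4 of the kernel. *)
Lemma normc_dispersion :
  kappa ^+ 4 * ComplexField.Normc.normc (dispersion k v) ^+ 2 =
  (kappa ^+ 2 + PsiR y) ^+ 2 + PsiI y ^+ 2.
Proof.
rewrite dispersionE.
have -> : 1 + (kappa ^- 2)%:C * (PsiR y +i* PsiI y) =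
    (1 + kappa ^- 2 * PsiR y) +i* (kappa ^- 2 * PsiI y).
  by simpc.
rewrite /ComplexField.Normc.normc sqr_sqrtr ?addr_ge0 ?sqr_ge0//.
by field; rewrite gt_eqF.
Qed.

End DispersionLimit.

End Dispersion.

(** * Size of the real and imaginary parts *)

Section GrowthBounds.
Context {R : realType}.
Local Notation mu := (@lebesgue_measure R).

Lemma integrable_exp_sqr_int (a b : R) :
  mu.-integrable `[a, b] (fun t => (expR (t ^+ 2 / 2))%:E).
Proof.
apply: continuous_compact_integrable; first exact: segment_compact.
exact/continuous_subspaceT/continuous_expR_sqr.
Qed.

Lemma exp_sqr_int_ge0 (y : R) : 0 <= exp_sqr_int y.
Proof. by apply: Rintegral_ge0 => t _; exact: expR_ge0. Qed.

Lemma exp_sqr_int_le (y : R) : 0 <= y -> exp_sqr_int y <= y * expR (y ^+ 2 / 2).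
Proof.
move=> y0; rewrite -lee_fin -exp_sqr_int_fin.
have -> : ((y * expR (y ^+ 2 / 2))%:E = \int[mu]_(t in `[0%R, y]) (cst (expR (y ^+ 2 / 2)) t)%:E)%E.
  have dF (x : R) : is_derive x 1 (fun t => t * expR (y ^+ 2 / 2)) (expR (y ^+ 2 / 2)).
    by apply: is_derive_eq; rewrite /GRing.scale/= mulr0 add0r mulr1.
  have cf : continuous (cst (expR (y ^+ 2 / 2)) : R -> R) by move=> t; exact: cst_continuous.
  by rewrite (integral_is_derive y0 cf dF) mul0r subr0.
apply: ge0_le_integral => //.
- apply: measurable_funTS; apply/measurable_EFinP.
  by apply: continuous_measurable_fun; exact: continuous_expR_sqr.
- exact/measurable_EFinP.
- move=> t; rewrite /= in_itv/= => /andP[t0 ty].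
  by rewrite lee_fin ler_expR ler_pM2r ?invr_gt0// ler_pXn2r ?nnegrE.
Qed.

(** Two terms of the expansion of int_0^y exp(t^2/2) dt at infinity, with a
    coefficient c instead of the exact 1: according to c, the derivative lies
    below or above exp(y^2/2). *)
Let is_derive_bound (c y : R) : 0 < y ->
  is_derive y 1 (fun t => expR (t ^+ 2 / 2) * (t^-1 + c * t ^- 3))
    (expR (y ^+ 2 / 2) * (1 + (c - 1) * y ^- 2 - 3 * c * y ^- 4)).
Proof.
move=> y0; have yn : y != 0 by rewrite gt_eqF.
have d1 : is_derive y 1 (fun t : R => t^-1) (- y ^- 2 * 1).
  exact: is_derive_invf.
have d3 : is_derive y 1 (fun t : R => (t ^+ 3)^-1) (- (y ^+ 3) ^- 2 * (3 * y ^+ 2)).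
  by apply: (@is_derive_invf _ (fun t => t ^+ 3)); rewrite ?expf_neq0//; exact: is_derive_exprf.
apply: is_derive_eq.
rewrite /GRing.scale/=; field.
by [].
Qed.

Let continuous_bound (c y : R) : 0 < y ->
  {for y, continuous (fun t : R => expR (t ^+ 2 / 2) * (1 + (c - 1) * t ^- 2 - 3 * c * t ^- 4))}.
Proof.
move=> y0; have yn : y != 0 by rewrite gt_eqF.
apply: differentiable_continuous; apply/derivable1_diffP.
have d2 : is_derive y 1 (fun t : R => (t ^+ 2)^-1) (- (y ^+ 2) ^- 2 * (2 * y ^+ 1)).
  by apply: (@is_derive_invf _ (fun t => t ^+ 2)); rewrite ?expf_neq0//; exact: is_derive_exprf.
have d4 : is_derive y 1 (fun t : R => (t ^+ 4)^-1) (- (y ^+ 4) ^- 2 * (4 * y ^+ 3)).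
  by apply: (@is_derive_invf _ (fun t => t ^+ 4)); rewrite ?expf_neq0//; exact: is_derive_exprf.
exact: ex_derive.
Qed.

Let integral_bound (c a b : R) : 0 < a -> a <= b ->
  (\int[mu]_(t in `[a, b]) (expR (t ^+ 2 / 2) * (1 + (c - 1) * t ^- 2 - 3 * c * t ^- 4))%:E =
   (expR (b ^+ 2 / 2) * (b^-1 + c * b ^- 3) - expR (a ^+ 2 / 2) * (a^-1 + c * a ^- 3))%:E)%E.
Proof.
move=> a0 ab.
apply: (@integral_is_derive_itv R
  (fun t => expR (t ^+ 2 / 2) * (1 + (c - 1) * t ^- 2 - 3 * c * t ^- 4))
  (fun t => expR (t ^+ 2 / 2) * (t^-1 + c * t ^- 3))) => // x /andP[ax _].
- by apply: continuous_bound; exact: lt_le_trans ax.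
- by apply: is_derive_bound; exact: lt_le_trans ax.
Qed.
(** Coefficient c = 1: the derivative of the expansion is exp(y^2/2) times
    1 - 3/y^4, which is at most exp(y^2/2). *)
Lemma exp_sqr_int_ge_asymptotic (y : R) : 1 <= y ->
  expR (y ^+ 2 / 2) * (y^-1 + y ^- 3) - 2 * expR (1 / 2) <= exp_sqr_int y.
Proof.
move=> y1; have y0 : 0 < y by exact: lt_le_trans y1.
have E := integral_bound 1 ltr01 y1.
have -> : expR (y ^+ 2 / 2) * (y^-1 + y ^- 3) - 2 * expR (1 / 2) =
    expR (y ^+ 2 / 2) * (y^-1 + 1 * y ^- 3) - expR (1 ^+ 2 / 2) * (1^-1 + 1 * 1 ^- 3).
  by rewrite !expr1n invr1 !mul1r; ring.
rewrite -lee_fin -E -exp_sqr_int_fin.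
apply: (@le_trans _ _ (\int[mu]_(t in `[1%R, y]) (expR (t ^+ 2 / 2))%:E)%E); last first.
  apply: ge0_subset_integral => //.
  - by case/integrableP: (integrable_exp_sqr_int 0 y).
  - by move=> t /=; rewrite !in_itv/= => /andP[t1 ->]; rewrite (le_trans _ t1).
have i1 := integrable_exp_sqr_int 1 y.
apply: le_integral => //.
  apply: continuous_compact_integrable; first exact: segment_compact.
  apply: continuous_in_subspaceT => t; rewrite inE/= in_itv/= => /andP[t1 _].
  by apply: continuous_bound; exact: lt_le_trans t1.
move=> t; rewrite inE/= in_itv/= => /andP[t1 _].
rewrite lee_fin -[leRHS]mulr1 ler_wpM2l ?expR_ge0// subrr mul0r addr0 mulr1.
have : 0 <= t ^- 4 by rewrite invr_ge0 exprn_even_ge0.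
lra.
Qed.

(** Coefficient c = 4: the derivative of the expansion is exp(y^2/2) times
    1 + 3/y^2 - 12/y^4, which is at least exp(y^2/2) once y >= 2. *)
Lemma exp_sqr_int_le_asymptotic (y : R) : 2 <= y ->
  exp_sqr_int y <= exp_sqr_int 2 + expR (y ^+ 2 / 2) * (y^-1 + 4 * y ^- 3).
Proof.
move=> y2; have y0 : 0 < y by exact: lt_le_trans y2.
have := integral_bound 4 (ltr0Sn R 1) y2 => E.
have i2 := integrable_exp_sqr_int 2 y; have iy := integrable_exp_sqr_int 0 y.
have -> : exp_sqr_int y = exp_sqr_int 2 + \int[mu]_(t in `[2, y]) expR (t ^+ 2 / 2).
  rewrite /exp_sqr_int -(@Rintegral_itv_obnd_cbnd R 2); last first.
    by apply: integrableS i2 => //; apply: subset_itvr; rewrite bnd_simp.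
  rewrite -(@Rintegral_itvB _ _ (BLeft 0) (BRight y) 2)//; first by ring.
  by rewrite bnd_simp ler0n.
rewrite lerD2l -lee_fin /Rintegral fineK; last exact: integrable_fin_num.
apply: (@le_trans _ _ (expR (y ^+ 2 / 2) * (y^-1 + 4 * y ^- 3) -
     expR (2 ^+ 2 / 2) * (2^-1 + 4 * 2 ^- 3))%:E); last first.
  rewrite lee_fin gerBl mulr_ge0 ?expR_ge0// addr_ge0 ?mulr_ge0 ?invr_ge0 ?exprn_ge0//.
rewrite -E; apply: le_integral => //.
  apply: continuous_compact_integrable; first exact: segment_compact.
  apply: continuous_in_subspaceT => t; rewrite inE/= in_itv/= => /andP[t1 _].
  by apply: continuous_bound; exact: lt_le_trans t1.
move=> t; rewrite inE/= in_itv/= => /andP[t2 _].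
rewrite lee_fin -[leLHS]mulr1 ler_wpM2l ?expR_ge0//.
have t0 : 0 < t by exact: lt_le_trans t2.
have : 4 * t ^- 4 <= t ^- 2.
  have -> : t ^- 2 = t ^+ 2 * t ^- 4 by field; rewrite gt_eqF.
  by rewrite ler_wpM2r ?invr_ge0 ?exprn_even_ge0//; nra.
lra.
Qed.

End GrowthBounds.

Section PsiBounds.
Context {R : realType}.
Implicit Types x y : R.

(** The n-th power of (1 + |x|)^2 <= 8 n exp(x^2/(4 n)), itself a consequence of
    1 + u <= exp u. *)
Lemma poly_le_expR (n : nat) x : (0 < n)%N ->
  (1 + `|x|) ^+ (2 * n) <= (8 * n%:R) ^+ n * expR (x ^+ 2 / 4).
Proof.
move=> n0; have np : 0 < n%:R :> R by rewrite ltr0n.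
have h1 : (1 + `|x|) ^+ 2 <= 2 * (1 + x ^+ 2).
  rewrite -(real_normK (num_real x)).
  by have := sqr_ge0 (`|x| - 1); nra.
have h2 : 2 * (1 + x ^+ 2) <= 8 * n%:R * expR (x ^+ 2 / 4 / n%:R).
  apply: (@le_trans _ _ (8 * n%:R * (1 + x ^+ 2 / 4 / n%:R))).
    have -> : 8 * n%:R * (1 + x ^+ 2 / 4 / n%:R) = 8 * n%:R + 2 * x ^+ 2.
      by field; rewrite gt_eqF.
    have : 1 <= n%:R :> R by rewrite ler1n.
    by have := sqr_ge0 x; lra.
  by rewrite ler_wpM2l ?expR_ge1Dx// mulr_ge0// ltW.
rewrite exprM; apply: (@le_trans _ _ ((8 * n%:R * expR (x ^+ 2 / 4 / n%:R)) ^+ n)).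
  apply: lerXn2r; rewrite ?nnegrE ?sqr_ge0//; last exact: le_trans h1 h2.
rewrite exprMn -expRM_natl le_eqVlt; apply/orP; left; apply/eqP.
by congr (_ * expR _); field; rewrite gt_eqF.
Qed.

Lemma PsiRE x : PsiR x = 1 - `|x| * (expR (- (`|x| ^+ 2 / 2)) * exp_sqr_int `|x|).
Proof. by rewrite /PsiR real_normK ?num_real. Qed.

Lemma PsiR_le1 x : PsiR x <= 1.
Proof. by rewrite /PsiR gerBl !mulr_ge0 ?expR_ge0 ?exp_sqr_int_ge0. Qed.

Lemma PsiR_ge x : 1 - x ^+ 2 <= PsiR x.
Proof.
rewrite PsiRE lerD2l lerN2 -(real_normK (num_real x)) expr2 ler_wpM2l//.
by rewrite expRN ler_pdivrMl ?expR_gt0// mulrC exp_sqr_int_le.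
Qed.

(** The leading terms cancel in 1 - y exp(- y^2/2) int_0^y exp(t^2/2) dt, and the
    next one, - 1/y^2, decides the sign.  The threshold makes the constants of
    integration, multiplied by y exp(- y^2/2), smaller than a fraction of
    1/y^2. *)
Lemma PsiR_asymptotic : exists2 Y : R, 2 <= Y & forall x, Y <= `|x| ->
  - (5 / x ^+ 2) <= PsiR x <= - ((2 * x ^+ 2)^-1).
Proof.
pose M := 4 * expR (1 / 2) + exp_sqr_int 2 :> R.
have M0 : 0 <= M by rewrite addr_ge0 ?mulr_ge0 ?expR_ge0 ?exp_sqr_int_ge0.
(* 256 = (8 * 2)^2 is the constant of poly_le_expR for n = 2. *)
exists (2 + 256 * M); first by rewrite lerDl mulr_ge0.
move=> x; rewrite PsiRE -(real_normK (num_real x)).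
move: (normr_ge0 x); move: `|x| => y y0 hy.
have y2 : 2 <= y by apply: le_trans hy; rewrite lerDl mulr_ge0.
have yM : 256 * M <= y by apply: le_trans hy; rewrite lerDr.
have yp : 0 < y by exact: lt_le_trans y2.
have yn : y != 0 by rewrite gt_eqF.
have y1 : 1 <= y by apply: le_trans y2; rewrite ler1n.
set E := expR (y ^+ 2 / 2); have Ep : 0 < E by exact: expR_gt0.
have MyE : M * y ^+ 3 <= E.
  have := @poly_le_expR 2 y isT; rewrite (ger0_norm y0) => h.
  have E4 : expR (y ^+ 2 / 4) <= E by rewrite ler_expR; have := sqr_ge0 y; lra.
  have y4 : y ^+ 4 <= (1 + y) ^+ 4 by rewrite ler_pXn2r ?nnegrE ?addr_ge0// lerDr.
  have : M * y ^+ 3 * 256 <= y ^+ 4.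
    by rewrite mulrAC [M * _]mulrC [leRHS]exprS ler_wpM2r// exprn_ge0.
  have : (8 * 2 :> R) ^+ 2 = 256 by ring.
  by move: h; rewrite /=; nra.
rewrite expRN -/E; set G := exp_sqr_int y.
have hl : E * (y^-1 + y ^- 3) - 2 * expR (1 / 2) <= G by exact: exp_sqr_int_ge_asymptotic.
have hu : G <= exp_sqr_int 2 + E * (y^-1 + 4 * y ^- 3) by exact: exp_sqr_int_le_asymptotic.
have c0 : 0 <= y / E by rewrite divr_ge0// ltW.
have -> : y * (E^-1 * G) = y / E * G by rewrite mulrA.
have K1 : 4 * expR (1 / 2) * y ^+ 3 <= E.
  apply: le_trans MyE; rewrite ler_wpM2r ?exprn_ge0// lerDl exp_sqr_int_ge0//.
have K2 : exp_sqr_int 2 * y ^+ 3 <= E.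
  by apply: le_trans MyE; rewrite ler_wpM2r ?exprn_ge0// lerDr mulr_ge0 ?expR_ge0.
have d1 : 4 * expR (1 / 2) * (y / E) <= y ^- 2.
  rewrite mulrA ler_pdivrMr// ler_pdivlMl ?exprn_gt0//.
  by apply: le_trans K1; rewrite le_eqVlt; apply/orP; left; apply/eqP; ring.
have d2 : exp_sqr_int 2 * (y / E) <= y ^- 2.
  rewrite mulrA ler_pdivrMr// ler_pdivlMl ?exprn_gt0//.
  by apply: le_trans K2; rewrite le_eqVlt; apply/orP; left; apply/eqP; ring.
have hl' := ler_wpM2l c0 hl; have hu' := ler_wpM2l c0 hu.
have e1 : y / E * (E * (y^-1 + y ^- 3) - 2 * expR (1 / 2)) =
    1 + y ^- 2 - 2 * expR (1 / 2) * (y / E) by field; rewrite yn gt_eqF.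
have e2 : y / E * (exp_sqr_int 2 + E * (y^-1 + 4 * y ^- 3)) =
    1 + 4 * y ^- 2 + exp_sqr_int 2 * (y / E) by field; rewrite yn gt_eqF.
have e3 : (2 * y ^+ 2)^-1 = y ^- 2 / 2 by field.
by rewrite e3 -/(5 * y ^- 2); apply/andP; split; lra.
Qed.

End PsiBounds.

(** * The resonant radial integral *)

Section Resonance.
Context {R : realType}.
Local Notation mu := (@lebesgue_measure R).

(** Write s^3 = s (s^2 + a) - a s: the first part is a logarithmic derivative,
    the second one the derivative of an arc tangent. *)
Lemma resonance_integral (a b k0 : R) : 0 < b -> 0 <= k0 ->
  (\int[mu]_(s in `[0%R, k0]) (s ^+ 3 / ((s ^+ 2 + a) ^+ 2 + b ^+ 2))%:E =
   ((ln ((k0 ^+ 2 + a) ^+ 2 + b ^+ 2) - ln (a ^+ 2 + b ^+ 2)) / 4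
     - a / (2 * b) * (atan ((k0 ^+ 2 + a) / b) - atan (a / b)))%:E)%E.
Proof.
move=> b0 k00; have bn : b != 0 by rewrite gt_eqF.
have dp (s : R) : 0 < (s ^+ 2 + a) ^+ 2 + b ^+ 2 by rewrite ltr_wpDl ?sqr_ge0// exprn_gt0.
have dn (s : R) : (s ^+ 2 + a) ^+ 2 + b ^+ 2 != 0 by rewrite gt_eqF.
pose F s := ln ((s ^+ 2 + a) ^+ 2 + b ^+ 2) / 4 - a / (2 * b) * atan ((s ^+ 2 + a) / b).
pose f s := s ^+ 3 / ((s ^+ 2 + a) ^+ 2 + b ^+ 2).
have cf : continuous f.
  apply: derivable_continuous => s.
  have dD : is_derive s 1 (fun t => ((t ^+ 2 + a) ^+ 2 + b ^+ 2)^-1)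
    (- ((s ^+ 2 + a) ^+ 2 + b ^+ 2) ^- 2 * (2 * (s ^+ 2 + a) * (2 * s))).
    apply: (@is_derive_invf _ (fun t => (t ^+ 2 + a) ^+ 2 + b ^+ 2)) => //.
    by apply: is_derive_eq; rewrite /GRing.scale/=; ring.
  exact: ex_derive.
have dF (s : R) : is_derive s 1 F (f s).
  have d1 : is_derive s 1 (fun t => ln ((t ^+ 2 + a) ^+ 2 + b ^+ 2))
    (((s ^+ 2 + a) ^+ 2 + b ^+ 2)^-1 * (2 * (s ^+ 2 + a) * (2 * s))).
    apply: is_derive_compf; first exact: is_derive1_ln.
    by apply: is_derive_eq; rewrite /GRing.scale/=; ring.
  have d2 : is_derive s 1 (fun t => atan ((t ^+ 2 + a) / b))
    ((1 + ((s ^+ 2 + a) / b) ^+ 2)^-1 * (2 * s / b)).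
    apply: is_derive_compf.
    by apply: is_derive_eq; rewrite /GRing.scale/=; ring.
  apply: is_derive_eq; rewrite /GRing.scale/= /f.
  have dn' : 1 + ((s ^+ 2 + a) / b) ^+ 2 != 0 by rewrite gt_eqF// ltr_wpDr ?sqr_ge0.
  have -> : 1 + ((s ^+ 2 + a) / b) ^+ 2 = ((s ^+ 2 + a) ^+ 2 + b ^+ 2) / b ^+ 2 by field.
  rewrite [s ^+ 3](_ : _ = s * (s ^+ 2 + a - a)); last by ring.
  move: (dn s); move: (s ^+ 2 + a) => w dw; by field; rewrite bn dw.
rewrite (integral_is_derive k00 cf dF) /F expr0n/= add0r.
by congr (_%:E); ring.
Qed.


(** The normalization that gives |PsiI x| = kI |x| exp(- x^2/2). *)
Let kI : R := pi * (Num.sqrt (2 * pi))^-1.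

Let kI_gt0 : 0 < kI.
Proof. by rewrite divr_gt0 ?pi_gt0// sqrtr_gt0 mulr_gt0// pi_gt0. Qed.

Lemma normr_PsiI (x : R) : `|PsiI x| = kI * (`|x| * expR (- (x ^+ 2 / 2))).
Proof.
rewrite /PsiI /gauss normrN !normrM (ger0_norm (pi_ge0 R)) (ger0_norm (expR_ge0 _)).
by rewrite (ger0_norm (_ : 0 <= (Num.sqrt (2 * pi))^-1)) ?invr_ge0 ?sqrtr_ge0// /kI; ring.
Qed.

Lemma normr_PsiI_le (x : R) : `|PsiI x| <= pi.
Proof.
rewrite /PsiI normrN normrM (ger0_norm (pi_ge0 R)) -[leRHS]mulr1.
by rewrite ler_wpM2l ?pi_ge0// mulgauss_le1.
Qed.

(** The two squares never vanish together: PsiI vanishes at 0 only, where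
    PsiR = 1. *)
Lemma plasma_den_gt0 (s x : R) : 0 < (s ^+ 2 + PsiR x) ^+ 2 + PsiI x ^+ 2.
Proof.
have [->|x0] := eqVneq x 0.
  have := PsiR_ge (0 : R); rewrite expr0n/= subr0 => h.
  rewrite ltr_pwDl ?sqr_ge0// exprn_gt0//.
  by have := sqr_ge0 s; lra.
rewrite ltr_wpDl ?sqr_ge0// -(real_normK (num_real (PsiI x))) normr_PsiI exprn_gt0//.
by rewrite mulr_gt0 ?kI_gt0// mulr_gt0 ?normr_gt0 ?expR_gt0.
Qed.

Lemma PsiR_decay : exists2 C : R, 0 < C & forall x, `|PsiR x| <= C / (1 + x ^+ 2).
Proof.
have [Y Y2 hY] := @PsiR_asymptotic R.
have Y0 : 0 <= Y by apply: le_trans Y2.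
exists ((1 + Y ^+ 2) ^+ 2 + 10).
  by rewrite ltr_wpDl ?sqr_ge0.
move=> x; have xp : 0 < 1 + x ^+ 2 by rewrite ltr_pwDl ?sqr_ge0.
rewrite ler_pdivlMr//.
have [xY|Yx] := leP Y `|x|.
  have /andP[h1 h2] := hY x xY.
  have x2 : 2 <= `|x| by exact: le_trans xY.
  have x4 : 4 <= x ^+ 2 by rewrite -(real_normK (num_real x)); nra.
  have h3 : 0 < x ^+ 2 by lra.
  have h4 : PsiR x <= 0 by apply: le_trans h2 _; rewrite oppr_le0 invr_ge0 mulr_ge0// ltW.
  apply: (@le_trans _ _ 10); last by rewrite lerDr sqr_ge0.
  apply: (@le_trans _ _ (5 / x ^+ 2 * (1 + x ^+ 2))).
    have h5 : `|PsiR x| <= 5 / x ^+ 2 by rewrite ler0_norm// lerNl.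
    exact: (ler_wpM2r (ltW xp) h5).
  by rewrite mulrAC ler_pdivrMr//; lra.
have x2Y : x ^+ 2 <= Y ^+ 2.
  by rewrite -(real_normK (num_real x)) ler_pXn2r ?nnegrE// ltW.
have h1 : `|PsiR x| <= 1 + Y ^+ 2.
  rewrite ler_norml; have := PsiR_le1 x; have := PsiR_ge x; have := sqr_ge0 Y.
  by move=> ? ? ?; apply/andP; split; lra.
apply: (@le_trans _ _ ((1 + Y ^+ 2) * (1 + Y ^+ 2))); last by rewrite -expr2 lerDl.
by rewrite ler_pM// ?lerD2l// ltW.
Qed.

(** For large |x|, the height |PsiR x| / |PsiI x| of the resonance, up to
    constant factors. *)
Definition resonance_weight (x : R) : R := expR (x ^+ 2 / 2) / (1 + `|x|) ^+ 3.

Let onex (x : R) : 0 < 1 + `|x|. Proof. by rewrite ltr_pwDl. Qed.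

Lemma resonance_weight_gt0 (x : R) : 0 < resonance_weight x.
Proof. by rewrite divr_gt0 ?expR_gt0// exprn_gt0. Qed.

Lemma poly_le_weight (x : R) : (1 + `|x|) ^+ 3 <= 24 ^+ 3 * resonance_weight x.
Proof.
rewrite /resonance_weight mulrA ler_pdivlMr ?exprn_gt0// -exprD.
have := @poly_le_expR R 3 x isT => h; apply: (le_trans h).
have -> : (8 * 3 : R) = 24 by ring.
by rewrite ler_wpM2l// ler_expR; have := sqr_ge0 x; lra.
Qed.

Definition radial_integral (k0 x : R) : \bar R :=
  (\int[mu]_(s in `[0%R, k0])
    (s ^+ 3 / ((s ^+ 2 + PsiR x) ^+ 2 + PsiI x ^+ 2))%:E)%E.

Let measurable_radial (x : R) : measurable_fun setT
  (fun s : R => (s ^+ 3 / ((s ^+ 2 + PsiR x) ^+ 2 + PsiI x ^+ 2))%:E).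
Proof.
apply/measurable_EFinP; apply: measurable_funM; first exact: measurable_funX.
apply: measurable_funV; apply: measurable_funD => //; apply: measurable_funX.
by apply: measurable_funD => //; exact: measurable_funX.
Qed.

Let integral_cube (c k0 : R) : 0 <= k0 ->
  (\int[mu]_(s in `[0%R, k0]) (c * s ^+ 3)%:E = (c * k0 ^+ 4 / 4)%:E)%E.
Proof.
move=> k00; have cf : continuous (fun s : R => c * s ^+ 3).
  by apply: derivable_continuous => s; apply: ex_derive.
have dF (s : R) : is_derive s 1 (fun s => c * s ^+ 4 / 4) (c * s ^+ 3).
  by apply: is_derive_eq; rewrite /GRing.scale/=; field.
by rewrite (integral_is_derive k00 cf dF) expr0n/= mulr0 mul0r subr0.
Qed.

(** For |x| <= 1/2, PsiR is bounded away from 0 and there is no resonance.  For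
    larger |x| use [resonance_integral]: the logarithm contributes at most a
    quadratic polynomial in |x|, negligible against the weight, and the arc
    tangents are bounded, so the main term is |PsiR x| / |PsiI x|. *)
Lemma radial_integral_le (k0 : R) : 0 < k0 -> exists2 C : R, 0 < C &
  forall x, (radial_integral k0 x <= (C * resonance_weight x)%:E)%E.
Proof.
move=> k00; have [Ca Ca0 hCa] := PsiR_decay.
have hCa1 x : `|PsiR x| <= Ca.
  apply: le_trans (hCa x) _; rewrite ler_pdivrMr ?ltr_pwDl ?sqr_ge0//.
  by rewrite ler_peMr ?(ltW Ca0)// lerDl sqr_ge0.
pose N := (k0 ^+ 2 + Ca) ^+ 2 + pi ^+ 2 : R.
pose L := `|2 * ln (kI / 2)|.
pose C1 := k0 ^+ 4 * 4.
pose C2 := (N + L + 1) * 24 ^+ 3.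
pose C3 := 6 * Ca / kI * pi.
have N0 : 0 <= N by rewrite addr_ge0 ?sqr_ge0.
have C10 : 0 < C1 by rewrite mulr_gt0// exprn_gt0.
have L0 : 0 <= L by exact: normr_ge0.
have NL1 : 0 <= N + L + 1 by rewrite addr_ge0// addr_ge0.
have C20 : 0 <= C2 by rewrite mulr_ge0 ?exprn_ge0.
have C30 : 0 <= C3 by rewrite mulr_ge0 ?pi_ge0// divr_ge0 ?(ltW kI_gt0)// mulr_ge0// ltW.
exists (C1 + C2 + C3); first by rewrite ltr_pwDl// ltr_pwDl.
move=> x; have wp := resonance_weight_gt0 x.
have [xs|xl] := leP `|x| (1 / 2).
  have x2 : x ^+ 2 <= 1 / 4.
    by rewrite -(real_normK (num_real x)); have := normr_ge0 x; nra.
  have a34 : 3 / 4 <= PsiR x by have := PsiR_ge x; lra.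
  apply: (@le_trans _ _ (\int[mu]_(s in `[0%R, k0]) (4 * s ^+ 3)%:E)%E).
    apply: ge0_le_integral => //.
    - move=> s; rewrite /= in_itv/= => /andP[s0 _].
      by rewrite lee_fin divr_ge0 ?exprn_ge0// ltW// plasma_den_gt0.
    - apply: measurable_funTS; exact: measurable_radial.
    - apply: measurable_funTS; apply/measurable_EFinP; apply: measurable_funM => //.
    - move=> s; rewrite /= in_itv/= => /andP[s0 _].
      rewrite lee_fin mulrC ler_wpM2r ?exprn_ge0// invf_ple ?posrE ?plasma_den_gt0//.
      have := sqr_ge0 (PsiI x); have := sqr_ge0 s; nra.
  rewrite (integral_cube _ (ltW k00)) lee_fin.
  have w4 : 1 / 4 <= resonance_weight x.
    rewrite /resonance_weight ler_pdivlMr ?exprn_gt0//.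
    have : (1 + `|x|) ^+ 3 <= (3 / 2) ^+ 3.
      by rewrite lerXn2r ?nnegrE ?addr_ge0//; lra.
    have : 1 <= expR (x ^+ 2 / 2).
      by rewrite -[leLHS]expR0 ler_expR; have := sqr_ge0 x; lra.
    have : (3 / 2 : R) ^+ 3 = 27 / 8 by field.
    lra.
  have h4 : 4 * k0 ^+ 4 / 4 = C1 * (1 / 4) by rewrite /C1; field.
  rewrite h4 (le_trans (ler_wpM2l (ltW C10) w4))// ler_wpM2r ?(ltW wp)//.
  by rewrite -addrA lerDl addr_ge0.
set b := `|PsiI x|; have x0 : 0 < `|x| by lra.
have b0 : 0 < b by rewrite /b normr_PsiI mulr_gt0 ?kI_gt0// mulr_gt0 ?expR_gt0.
rewrite /radial_integral -(real_normK (num_real (PsiI x))) -/b.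
rewrite (resonance_integral _ b0 (ltW k00)) lee_fin.
set a := PsiR x; set D := _ + b ^+ 2; set D0 := a ^+ 2 + b ^+ 2.
have D0p : 0 < D0 by rewrite ltr_wpDl ?sqr_ge0// exprn_gt0.
have Dp : 0 < D by rewrite ltr_wpDl ?sqr_ge0// exprn_gt0.
have lnD : ln D <= N.
  apply: (le_trans (ltW (ln_sublinear Dp))); apply: lerD.
    rewrite -(real_normK (num_real (k0 ^+ 2 + a))) lerXn2r ?nnegrE//.
      by rewrite addr_ge0 ?sqr_ge0// ltW.
    apply: (le_trans (ler_normD _ _)).
    by rewrite (ger0_norm (sqr_ge0 k0)) lerD2l; exact: hCa1.
  by rewrite lerXn2r ?nnegrE ?pi_ge0 ?normr_PsiI_le// ltW.
have lnD0 : - ln D0 <= L + x ^+ 2.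
  have h1 : ln (b ^+ 2) <= ln D0.
    by rewrite ler_ln ?posrE ?exprn_gt0// lerDr sqr_ge0.
  have h2 : ln (b ^+ 2) = 2 * ln (kI * `|x|) - x ^+ 2.
    have kx : 0 < kI * `|x| by exact: mulr_gt0 kI_gt0 x0.
    rewrite lnXn// /b normr_PsiI mulrA.
    rewrite [ln (_ * expR _)]lnM ?posrE ?expR_gt0// expRK.
    by rewrite mulr2n; field.
  have h3 : ln (kI / 2) <= ln (kI * `|x|).
    have k2 : 0 < kI / 2 by exact: divr_gt0.
    rewrite ler_ln ?posrE ?(mulr_gt0 kI_gt0 x0)//.
    by apply: (ler_wpM2l (ltW kI_gt0)); lra.
  have h4 : - (2 * ln (kI / 2)) <= L by rewrite /L -normrN ler_norm.
  lra.
have p2 : 1 + x ^+ 2 <= (1 + `|x|) ^+ 2.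
  by rewrite -(real_normK (num_real x)); nra.
have T1 : (ln D - ln D0) / 4 <= C2 * resonance_weight x.
  rewrite /C2 -mulrA; apply: (@le_trans _ _ ((N + L + 1) * (1 + `|x|) ^+ 3)); last first.
    by rewrite ler_wpM2l ?poly_le_weight.
  have p3 : 1 + x ^+ 2 <= (1 + `|x|) ^+ 3.
    by rewrite (le_trans p2)// ler_weXn2l// lerDl.
    have := sqr_ge0 x; nra.
have hab : `|a| / (2 * b) <= 3 * Ca / kI * resonance_weight x.
  rewrite ler_pdivrMr ?mulr_gt0//; apply: (le_trans (hCa x)).
  rewrite /b normr_PsiI /resonance_weight expRN.
  have -> : 3 * Ca / kI * (expR (x ^+ 2 / 2) / (1 + `|x|) ^+ 3) *
      (2 * (kI * (`|x| / expR (x ^+ 2 / 2)))) = Ca * (6 * `|x| / (1 + `|x|) ^+ 3).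
    by field; rewrite !gt_eqF ?expR_gt0.
  rewrite ler_wpM2l ?(ltW Ca0)// ler_pdivlMr ?exprn_gt0// mulrC.
  rewrite ler_pdivrMr ?ltr_pwDl ?sqr_ge0//.
  rewrite -(real_normK (num_real x)); move: `|x| xl => y hy; nra.
have at_pi u w : `|atan u - atan w| <= pi :> R.
  have := atan_gtNpi2 u; have := atan_ltpi2 u; have := atan_gtNpi2 w; have := atan_ltpi2 w.
  by move=> ? ? ? ?; rewrite ler_norml; apply/andP; split; lra.
have T2 : - (a / (2 * b) * (atan ((k0 ^+ 2 + a) / b) - atan (a / b))) <= C3 * resonance_weight x.
  apply: (le_trans (ler_norm _)); rewrite normrN normrM normrM normfV.
  rewrite (ger0_norm (_ : 0 <= 2 * b)) ?mulr_ge0 ?(ltW b0)//.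
  apply: (le_trans (ler_pM _ _ hab (at_pi _ _))) => //.
    by rewrite divr_ge0// mulr_ge0// ltW.
  have -> : C3 * resonance_weight x = 2 * (3 * Ca / kI * resonance_weight x * pi).
    by rewrite /C3; ring.
  by rewrite ler_peMl// ?ler1n// mulr_ge0 ?pi_ge0// mulr_ge0 ?(ltW wp)// divr_ge0 ?(ltW kI_gt0)// mulr_ge0// ltW.
have := mulr_gt0 C10 wp.
lra.
Qed.

(** For large |x|, PsiR x is negative, at most k0^2/2 and at least |PsiI x| in
    absolute value: in [resonance_integral] the logarithm of the quotient is
    nonnegative and one arc tangent is at least pi/4, which leaves a multiple
    of |PsiR x| / |PsiI x|.  For bounded |x|, the denominator is bounded. *)
Lemma radial_integral_ge (k0 : R) : 0 < k0 -> exists2 c : R, 0 < c &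
  forall x, ((c * resonance_weight x)%:E <= radial_integral k0 x)%E.
Proof.
move=> k00; have [Ca Ca0 hCa] := PsiR_decay.
have hCa1 x : `|PsiR x| <= Ca.
  apply: le_trans (hCa x) _; rewrite ler_pdivrMr ?ltr_pwDl ?sqr_ge0//.
  by rewrite ler_peMr ?(ltW Ca0)// lerDl sqr_ge0.
have [Y Y2 hY] := @PsiR_asymptotic R.
have k2 : 0 < k0 ^+ 2 by rewrite exprn_gt0.
(* Beyond X: the expansion of PsiR holds, |PsiR| <= k0^2/2 so that the resonance
   is inside the domain, and |PsiI| <= |PsiR|. *)
pose X := Y + 10 / k0 ^+ 2 + 2 * 256 * kI.
have X0 : 0 <= X.
  have Y0 : 0 <= Y by exact: le_trans Y2.
  have := kI_gt0; have : 0 < 10 / k0 ^+ 2 by rewrite divr_gt0.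
  by rewrite /X; lra.
pose N := (k0 ^+ 2 + Ca) ^+ 2 + pi ^+ 2 : R.
have N0 : 0 < N by rewrite ltr_wpDl ?sqr_ge0// exprn_gt0// pi_gt0.
pose c1 := k0 ^+ 4 / (4 * N) / expR (X ^+ 2 / 2).
pose c2 := pi / 16 / kI.
have c10 : 0 < c1.
  by rewrite /c1 divr_gt0 ?expR_gt0// divr_gt0 ?exprn_gt0// mulr_gt0.
have c20 : 0 < c2.
  by have := kI_gt0; rewrite /c2 => h; rewrite divr_gt0// divr_gt0// pi_gt0.
exists (Num.min c1 c2); first by rewrite lt_min c10.
move=> x; have wp := resonance_weight_gt0 x.
have w1 : resonance_weight x <= expR (x ^+ 2 / 2).
  rewrite ler_pdivrMr ?exprn_gt0// ler_peMr ?expR_ge0//.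
  by rewrite exprn_ege1// lerDl.
have [xX|Xx] := leP `|x| X.
  apply: (@le_trans _ _ (\int[mu]_(s in `[0%R, k0]) (N^-1 * s ^+ 3)%:E)%E).
    rewrite (integral_cube _ (ltW k00)) lee_fin.
    apply: (@le_trans _ _ (c1 * resonance_weight x)).
      by rewrite ler_wpM2r ?(ltW wp)// ge_min lexx.
    apply: (@le_trans _ _ (c1 * expR (X ^+ 2 / 2))).
      rewrite ler_wpM2l ?(ltW c10)// (le_trans w1)// ler_expR ler_pM2r ?invr_gt0//.
      by rewrite -(real_normK (num_real x)) lerXn2r ?nnegrE.
    rewrite le_eqVlt; apply/orP; left; apply/eqP; rewrite /c1; field.
    by rewrite !gt_eqF ?expR_gt0.
  apply: ge0_le_integral => //.
  - move=> s; rewrite /= in_itv/= => /andP[s0 _].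
    by rewrite lee_fin mulr_ge0 ?exprn_ge0// invr_ge0 ltW.
  - apply: measurable_funTS; apply/measurable_EFinP; apply: measurable_funM => //.
  - by apply: measurable_funTS; exact: measurable_radial.
  - move=> s; rewrite /= in_itv/= => /andP[s0 sk].
    rewrite lee_fin mulrC ler_wpM2l ?exprn_ge0// lef_pV2 ?posrE ?plasma_den_gt0//.
    have s2 : s ^+ 2 <= k0 ^+ 2 by rewrite lerXn2r ?nnegrE ?(ltW k00).
    apply: lerD; rewrite -real_normK ?num_real// lerXn2r ?nnegrE ?pi_ge0 ?normr_PsiI_le//.
      by rewrite addr_ge0 ?(ltW k2) ?(ltW Ca0).
    apply: (le_trans (ler_normD _ _)); rewrite (ger0_norm (sqr_ge0 s)).
    exact: lerD.
apply: (@le_trans _ _ (c2 * resonance_weight x)%:E).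
  by rewrite lee_fin ler_wpM2r ?(ltW wp)// ge_min lexx orbT.
have kk : 0 <= 10 / k0 ^+ 2 by rewrite divr_ge0 ?(ltW k2).
have kI0 := kI_gt0.
have Yx : Y <= `|x| by rewrite /X in Xx; lra.
have x2 : 2 <= `|x| by exact: le_trans Yx.
have xp : 0 < `|x| by lra.
have kx : 10 / k0 ^+ 2 <= `|x| by rewrite /X in Xx; lra.
have kIx : 2 * 256 * kI <= `|x| by rewrite /X in Xx; lra.
have /andP[h1 h2] := hY x Yx.
have x2p : 0 < x ^+ 2 by rewrite -(real_normK (num_real x)) exprn_gt0.
set b := `|PsiI x|.
have b0 : 0 < b by rewrite /b normr_PsiI mulr_gt0 ?kI_gt0// mulr_gt0 ?expR_gt0.
rewrite /radial_integral -(real_normK (num_real (PsiI x))) -/b.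
rewrite (resonance_integral _ b0 (ltW k00)) lee_fin.
have [al alE] : exists al, PsiR x = - al by exists (- PsiR x); rewrite opprK.
rewrite alE in h1 h2 *; rewrite lerN2 in h1; rewrite lerN2 in h2.
have al0 : 0 < al by apply: lt_le_trans h2; rewrite invr_gt0 mulr_gt0.
have alk : al <= k0 ^+ 2 / 2.
  apply: (le_trans h1); rewrite ler_pdivrMr// mulrAC ler_pdivlMr//.
  have : 10 <= `|x| * k0 ^+ 2 by rewrite -ler_pdivrMr.
  by rewrite -(real_normK (num_real x)); nra.
have bal : b <= al.
  apply: (le_trans _ h2); rewrite /b normr_PsiI expRN.
  rewrite -(real_normK (num_real x)) -[leRHS]div1r.
  rewrite ler_pdivlMr; last by rewrite mulr_gt0// exprn_gt0.
  have -> : kI * (`|x| / expR (`|x| ^+ 2 / 2)) * (2 * `|x| ^+ 2) =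
     2 * kI * `|x| ^+ 3 / expR (`|x| ^+ 2 / 2) by ring.
  rewrite ler_pdivrMr ?expR_gt0// mul1r.
  have h := @poly_le_expR R 2 `|x| isT; rewrite (ger0_norm (normr_ge0 x)) in h.
  have y4 : `|x| ^+ 4 <= (1 + `|x|) ^+ 4 by rewrite lerXn2r ?nnegrE ?addr_ge0// lerDr.
  have E4 : expR (`|x| ^+ 2 / 4) <= expR (`|x| ^+ 2 / 2).
    by rewrite ler_expR; have := sqr_ge0 `|x|; lra.
  have h3 : 2 * 256 * kI * `|x| ^+ 3 <= `|x| ^+ 4.
    by rewrite [leRHS]exprS ler_wpM2r// exprn_ge0.
  have e256 : (8 * 2 :> R) ^+ 2 = 256 by ring.
  rewrite e256 /= in h; lra.
have lnp : 0 <= ln ((k0 ^+ 2 + - al) ^+ 2 + b ^+ 2) - ln ((- al) ^+ 2 + b ^+ 2).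
  rewrite subr_ge0 ler_ln ?posrE; [|by rewrite ltr_wpDl ?sqr_ge0// exprn_gt0..].
  by rewrite lerD2r sqrrN lerXn2r ?nnegrE ?(ltW al0)//; lra.
have at1 : 0 <= atan ((k0 ^+ 2 + - al) / b).
  rewrite -[leLHS](@atan0 R); apply: le_atan; rewrite divr_ge0 ?(ltW b0)//; lra.
have at2 : pi / 4 <= atan (al / b).
  by rewrite -(@atan1 R); apply: le_atan; rewrite ler_pdivlMr// mul1r.
have alb : 0 <= al / (2 * b) by rewrite divr_ge0 ?(ltW al0)// mulr_ge0// ltW.
have E0 : c2 * resonance_weight x <= al / (2 * b) * (pi / 4).
  have -> : al / (2 * b) * (pi / 4) = pi / 8 * al / b by field; rewrite gt_eqF.
  rewrite ler_pdivlMr// /b normr_PsiI expRN /resonance_weight.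
  have -> : c2 * (expR (x ^+ 2 / 2) / (1 + `|x|) ^+ 3) *
     (kI * (`|x| / expR (x ^+ 2 / 2))) = pi / 8 * (`|x| / (2 * (1 + `|x|) ^+ 3)).
    by rewrite /c2; field; rewrite !gt_eqF ?expR_gt0.
  rewrite ler_wpM2l ?divr_ge0 ?pi_ge0//; apply: (le_trans _ h2).
  have xp3 : 0 < 2 * (1 + `|x|) ^+ 3 by rewrite mulr_gt0 ?exprn_gt0.
  have x2p2 : 0 < 2 * x ^+ 2 by rewrite mulr_gt0.
  rewrite ler_pdivrMr// ler_pdivlMl// -(real_normK (num_real x)).
  rewrite -mulrA ler_wpM2l// mulrC -exprS lerXn2r ?nnegrE ?addr_ge0//.
  by rewrite lerDr.
have : - (- al / (2 * b) * (atan ((k0 ^+ 2 + - al) / b) - atan (- al / b))) =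
   al / (2 * b) * (atan ((k0 ^+ 2 + - al) / b) + atan (al / b)).
  by rewrite !mulNr atanN !opprK.
have := ler_wpM2l alb (lerD at1 at2); rewrite add0r.
move: E0; move: (_ * (pi / 4)) => u; move: (al / (2 * b) * (atan _ + _)) => w; lra.
Qed.

End Resonance.

(** * Geometry of the plane orthogonal to the relative velocity *)

Section FrameGeometry.
Context {R : realType}.
Variable z : 'cV[R]_3.
Hypothesis z0 : z <> 0.

Let n : 'cV[R]_3 := (enorm z)^-1 *: z.
Let e1 := (frame z).1.
Let e2 := (frame z).2.

Let zn : enorm z != 0. Proof. by rewrite gt_eqF// enorm_gt0. Qed.

(** The matrix with rows e1, e2, z/|z|; Parseval's identity says that its
    transpose is its inverse on both sides. *)
Let frame_mx : 'M[R]_3 := \matrix_(i < 3) (nth 0 [:: e1; e2; n] i)^T.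

Let frame_mxE (w : 'cV[R]_3) i : (frame_mx *m w) i 0 = dot (nth 0 [:: e1; e2; n] i) w.
Proof. by rewrite mxE; apply: eq_bigr => j _; rewrite !mxE. Qed.

Let frame_mx_orthogonal : frame_mx *m frame_mx^T = 1%:M.
Proof.
have [h1 h2 h11 h22 h12] := frameP z0; rewrite -/e1 -/e2 in h1 h2 h11 h22 h12.
have hn1 : dot e1 n = 0 by rewrite dotZr h1 mulr0.
have hn2 : dot e2 n = 0 by rewrite dotZr h2 mulr0.
have hnn : dot n n = 1.
  by rewrite dotZl dotZr -enorm_sqr expr2 mulKf// mulVf.
apply/matrixP => i j.
have -> : (frame_mx *m frame_mx^T) i j =
  dot (nth 0 [:: e1; e2; n] i) (nth 0 [:: e1; e2; n] j).
  by rewrite mxE; apply: eq_bigr => l _; rewrite !mxE.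
rewrite mxE; case: i => -[|[|[|//]]] hi; case: j => -[|[|[|//]]] hj /=;
  rewrite ?h11 ?h22 ?h12 ?hn1 ?hn2 ?hnn// dotC ?h12 ?hn1 ?hn2//.
Qed.

Lemma frame_parseval (u w : 'cV[R]_3) : dot u w =
  dot e1 u * dot e1 w + dot e2 u * dot e2 w + dot n u * dot n w.
Proof.
have -> : dot u w = (u^T *m w) 0 0.
  by rewrite mxE; apply: eq_bigr => i _; rewrite !mxE.
have -> : u^T *m w = (frame_mx *m u)^T *m (frame_mx *m w).
  by rewrite trmx_mul -mulmxA [frame_mx^T *m _]mulmxA (mulmx1C frame_mx_orthogonal) mul1mx.
rewrite mxE !big_ord_recl big_ord0 addr0 addrA.
by congr (_ + _ + _); rewrite mxE !frame_mxE.
Qed.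

Lemma vR_frame (v : 'cV[R]_3) :
  vR v z = Num.sqrt (dot e1 v ^+ 2 + dot e2 v ^+ 2).
Proof. by rewrite /vR enorm_sqr frame_parseval -!expr2 addrK. Qed.

Lemma enorm_dirproj (u : 'cV[R]_3) :
  enorm (u - dirproj z u) ^+ 2 = dot e1 u ^+ 2 + dot e2 u ^+ 2.
Proof.
have [h1 h2 h11 h22 h12] := frameP z0; rewrite -/e1 -/e2 in h1 h2 h11 h22 h12.
rewrite enorm_sqr frame_parseval -!expr2 /dirproj -/n !dotBr !dotZr h1 h2.
have -> : dot n z = enorm z.
  by rewrite dotZl -enorm_sqr expr2 mulKf.
by rewrite !mulr0 !subr0 mulVf// mulr1 subrr expr0n addr0.
Qed.

Lemma plane_vec_dot (p : R * R) (w : 'cV[R]_3) :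
  dot (plane_vec z p) w = p.1 * dot e1 w + p.2 * dot e2 w.
Proof. by rewrite /plane_vec dotDl !dotZl. Qed.

Lemma plane_vec_norm (p : R * R) :
  enorm (plane_vec z p) ^+ 2 = p.1 ^+ 2 + p.2 ^+ 2.
Proof.
have [_ _ h11 h22 h12] := frameP z0.
rewrite enorm_sqr plane_vec_dot ![dot _ (plane_vec _ _)]dotC !plane_vec_dot /e1 /e2.
by rewrite h11 h22 [dot (frame z).2 _]dotC h12; ring.
Qed.

End FrameGeometry.

(** * Slope coordinates in the plane *)

Section SlopeCoordinates.
Context {R : realType}.
Local Notation mu := (@lebesgue_measure R).

Lemma exp_sqr_int_nondecreasing : nondecreasing_fun (@exp_sqr_int R).
Proof.
move=> x y xy; rewrite -lee_fin -!exp_sqr_int_fin.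
apply: ge0_subset_integral => //.
- by case/integrableP: (integrable_exp_sqr_int 0 y).
- by move=> t /=; rewrite !in_itv/= => /andP[-> tx]; rewrite (le_trans tx).
Qed.

Lemma measurable_PsiR : measurable_fun setT (@PsiR R).
Proof.
apply: measurable_funB => //; apply: measurable_funM.
  exact: normr_measurable.
apply: measurable_funM.
  apply: measurableT_comp => //; apply: measurable_funN.
  by apply: measurable_funM => //; exact: measurable_funX.
apply: measurableT_comp; last exact: normr_measurable.
by apply: nondecreasing_measurable => //; exact: exp_sqr_int_nondecreasing.
Qed.

Lemma measurable_PsiI : measurable_fun setT (@PsiI R).
Proof.
apply: measurable_funN; apply: measurable_funM => //.
by apply: measurable_funM => //; exact: measurable_gauss.
Qed.

Lemma measurable_sqrtf d (T : measurableType d) (f : T -> R) :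
  measurable_fun setT f -> measurable_fun setT (fun x => Num.sqrt (f x)).
Proof.
move=> mf; apply: measurableT_comp => //.
by apply: continuous_measurable_fun; exact: sqrt_continuous.
Qed.

(** The square modulus |k|^4 |eps|^2, for |k|^2 = m. *)
Definition plasma_den (x m : R) : R := (m + PsiR x) ^+ 2 + PsiI x ^+ 2.

Lemma plasma_den_pos (x m : R) : 0 <= m -> 0 < plasma_den x m.
Proof. by move=> m0; rewrite /plasma_den -(sqr_sqrtr m0) plasma_den_gt0. Qed.

Lemma plasma_denN (x m : R) : plasma_den (- x) m = plasma_den x m.
Proof. by rewrite /plasma_den /PsiR /PsiI normrN sqrrN gaussN mulNr mulrN !sqrrN. Qed.

Definition planar_den (a b : R) (p : R * R) : R :=
  plasma_den ((p.1 * a + p.2 * b) / Num.sqrt (p.1 ^+ 2 + p.2 ^+ 2)) (p.1 ^+ 2 + p.2 ^+ 2).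

(** The component of v along the unit vector of slope t, where a and b are the
    coordinates of v in the frame. *)
Definition slope_proj (a b t : R) : R := (a + t * b) / Num.sqrt (1 + t ^+ 2).

(** For negative s the direction of slope t is reversed; PsiR and the square of
    PsiI are even. *)
Lemma planar_den_slope (a b s t : R) : s != 0 ->
  planar_den a b (s, t * s) = plasma_den (slope_proj a b t) (s ^+ 2 * (1 + t ^+ 2)).
Proof.
move=> s0; rewrite /planar_den /=.
have -> : s ^+ 2 + (t * s) ^+ 2 = s ^+ 2 * (1 + t ^+ 2) by ring.
rewrite sqrtrM ?sqr_ge0// sqrtr_sqr.
have tp : Num.sqrt (1 + t ^+ 2) != 0 by rewrite gt_eqF// sqrtr_gt0 ltr_pwDl ?sqr_ge0.
rewrite /slope_proj; have [sp|sn] := leP 0 s.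
  rewrite ger0_norm// (_ : (s * a + t * s * b) / _ = (a + t * b) / Num.sqrt (1 + t ^+ 2))//.
  by field; rewrite tp s0.
rewrite ltr0_norm// -[RHS]plasma_denN.
rewrite (_ : (s * a + t * s * b) / _ = - ((a + t * b) / Num.sqrt (1 + t ^+ 2)))//.
by field; rewrite tp s0.
Qed.

Lemma measurable_planar_den (a b : R) :
  measurable_fun setT (fun p : measurableTypeR R * measurableTypeR R => planar_den a b p).
Proof.
have m1 : measurable_fun setT
   (fun p : measurableTypeR R * measurableTypeR R => p.1 ^+ 2 + p.2 ^+ 2 : R).
  by apply: measurable_funD; apply: measurable_funX.
have mx : measurable_fun setT (fun p : measurableTypeR R * measurableTypeR R =>
    (p.1 * a + p.2 * b) / Num.sqrt (p.1 ^+ 2 + p.2 ^+ 2) : R).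
  apply: measurable_funM; last by apply: measurable_funV; exact: measurable_sqrtf.
  by apply: measurable_funD; apply: measurable_funM.
apply: measurable_funD; apply: measurable_funX.
  by apply: measurable_funD => //; exact: (measurableT_comp measurable_PsiR mx).
exact: (measurableT_comp measurable_PsiI mx).
Qed.

(** The first coordinate in the plane runs over both signs, hence the factor 2. *)
Lemma radial_integral_even (k0 x : R) :
  (\int[mu]_s (`|s| ^+ 3 / plasma_den x (s ^+ 2) * \1_(`[- k0, k0]) s)%:E =
   2%:E * radial_integral k0 x)%E.
Proof.
pose H (s : R) : R := `|s| ^+ 3 / plasma_den x (s ^+ 2) * \1_(`[- k0, k0]) s.
have H0 s : 0 <= H s.
  by rewrite mulr_ge0// divr_ge0 ?exprn_ge0// ltW// plasma_den_pos ?sqr_ge0.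
have HN s : H (- s) = H s.
  rewrite /H normrN sqrrN !indicE; congr (_ * (_ : bool)%:R).
  by apply/idP/idP; rewrite !inE/= !in_itv/= => /andP[h1 h2]; apply/andP; split; lra.
have mH : measurable_fun setT H.
  apply: measurable_funM; last exact: measurable_indic.
  apply: measurable_funM; first by apply: measurable_funX; exact: normr_measurable.
  apply: measurable_funV; apply: measurable_funD; apply: measurable_funX => //.
  by apply: measurable_funD => //; exact: measurable_funX.
pose H1 (s : R) : R := H s * \1_(`[0, +oo[) s.
have mH1 : measurable_fun setT (EFin \o H1).
  by apply/measurable_EFinP; apply: measurable_funM => //; exact: measurable_indic.
have H10 s : (0 <= (EFin \o H1) s)%E by rewrite lee_fin mulr_ge0.
have E1 : (\int[mu]_s (H1 s)%:E = radial_integral k0 x)%E.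
  rewrite /radial_integral [RHS]integral_mkcond; apply: eq_integral => s _.
  rewrite patchE /H1 /H !indicE.
  rewrite (_ : (s \in `[- k0, k0]%classic) = (s \in `[- k0, k0]%R)); last by rewrite mem_setE.
  rewrite !mem_setE !in_itv/= andbT.
  have [s0|s0] /= := leP 0 s; last by rewrite mulr0.
  rewrite ger0_norm// mulr1; case: (leP s k0) => sk; rewrite ?andbF ?mulr0// andbT.
  by rewrite (_ : - k0 <= s) ?mulr1//; lra.
have n1 : -1 != 0 :> R by rewrite oppr_eq0 oner_neq0.
transitivity (\int[mu]_s ((EFin \o H1) s + (EFin \o H1) (-1 * s + 0)%R))%E.
  apply: eq_integral => s _; rewrite /= -EFinD; congr (_%:E); rewrite -/(H s).
  rewrite addr0 mulN1r /H1 HN !indicE !mem_setE !in_itv/= !andbT oppr_ge0.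
  have [s0|s0|s0] := ltgtP s 0; rewrite ?mulr0 ?mulr1 ?add0r ?addr0//.
  by rewrite s0 /H normr0 expr0n/= !mul0r addr0.
rewrite ge0_integralD//; last by apply: (measurableT_comp mH1); exact: measurable_affine.
rewrite (ge0_integral_affine 0 n1 mH1 H10) normrN normr1 invr1 mul1e /= E1.
by rewrite mule_natl mule2n.
Qed.

Section PlanarIntegral.
Variables (k0 a b : R) (Q : R * R -> R).
Hypotheses (k00 : 0 < k0) (Q0 : forall p, 0 <= Q p)
  (Qhom : forall s t, Q (s, t * s) = s ^+ 2 * Q (1, t))
  (mQ : measurable_fun setT (Q : measurableTypeR R * measurableTypeR R -> R)).

Definition disc (r : R) : set (R * R) := [set p | p.1 ^+ 2 + p.2 ^+ 2 <= r ^+ 2].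

Let F (p : measurableTypeR R * measurableTypeR R) : R :=
  Q p / planar_den a b p * \1_(`]-oo, (k0 ^+ 2)]) (p.1 ^+ 2 + p.2 ^+ 2).

Let m1 (t : R) : 0 < 1 + t ^+ 2. Proof. by rewrite ltr_pwDl ?sqr_ge0. Qed.

Let F0 p : 0 <= F p.
Proof.
rewrite mulr_ge0 ?indicE ?ler0n// divr_ge0// ltW// plasma_den_pos//.
by rewrite addr_ge0 ?sqr_ge0.
Qed.

Let mF : measurable_fun setT F.
Proof.
apply: measurable_funM.
  by apply: measurable_funM => //; apply: measurable_funV; exact: measurable_planar_den.
have mI : measurable_fun setT (\1_(`]-oo, (k0 ^+ 2)]) : R -> R) by exact: measurable_indic.
apply: (measurableT_comp mI).
by apply: measurable_funD; apply: measurable_funX.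
Qed.

(** The integrand after the substitution p2 = t p1; it vanishes for p1 = 0, where
    the substitution is not allowed. *)
Let G (p : measurableTypeR R * measurableTypeR R) : R := `|p.1| * F (p.1, p.2 * p.1).

Let G0 p : (0 <= (EFin \o G) p)%E. Proof. by rewrite lee_fin mulr_ge0. Qed.

Let mG : measurable_fun setT (EFin \o G).
Proof.
apply/measurable_EFinP; apply: measurable_funM.
  by apply: measurableT_comp => //; exact: normr_measurable.
apply: (measurableT_comp mF).
by apply: measurable_fun_pair => //; apply: measurable_funM.
Qed.

Let H (t s : R) : R :=
  `|s| ^+ 3 / plasma_den (slope_proj a b t) (s ^+ 2) * \1_(`[- k0, k0]) s.

Let GE (s t : R) : G (s, t) =
  Q (1, t) / (1 + t ^+ 2) / Num.sqrt (1 + t ^+ 2) * H t (Num.sqrt (1 + t ^+ 2) * s).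
Proof.
set m := Num.sqrt _; have mp : 0 < m by rewrite sqrtr_gt0.
have m2 : m ^+ 2 = 1 + t ^+ 2 by rewrite sqr_sqrtr// ltW.
rewrite /G /F /H /=.
have [->|s0] := eqVneq s 0.
  by rewrite normr0 mul0r mulr0 normr0 expr0n/= !(mul0r, mulr0).
rewrite Qhom planar_den_slope// -m2.
have -> : s ^+ 2 + (t * s) ^+ 2 = (m * s) ^+ 2 by rewrite [(m * s) ^+ 2]exprMn m2; ring.
have -> : s ^+ 2 * m ^+ 2 = (m * s) ^+ 2 by ring.
have dp := @plasma_den_pos (slope_proj a b t) _ (sqr_ge0 (m * s)).
have -> : \1_`]-oo, (k0 ^+ 2)] ((m * s) ^+ 2) = \1_`[- k0, k0] (m * s) :> R.
  rewrite !indicE !mem_setE !in_itv/=; congr (_ : bool)%:R.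
  by rewrite -(real_normK (num_real (m * s))) ler_pXn2r ?nnegrE ?(ltW k00)// ler_norml.
rewrite normrM (gtr0_norm mp) -(real_normK (num_real s)).
by field; rewrite !gt_eqF.
Qed.

(** For fixed t, rescaling p1 by sqrt(1 + t^2) brings the inner integral to the
    radial one; the weight of Q = p1^2 + p2^2 is the angular measure
    dt/(1 + t^2). *)
Lemma planar_integral :
  (\int[(mu \x mu)%E]_(p in disc k0) (Q p / planar_den a b p)%:E =
   \int[mu]_t ((2 * Q (1, t) / (1 + t ^+ 2) ^+ 2)%:E *
       radial_integral k0 (slope_proj a b t)))%E.
Proof.
have F0E p : (0 <= (EFin \o F) p)%E by rewrite lee_fin.
have mFE : measurable_fun setT (EFin \o F) by exact/measurable_EFinP.
transitivity (\int[(mu \x mu)%E]_p (EFin \o F) p)%E.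
  rewrite integral_mkcond; apply: eq_integral => p _.
  rewrite patchE; case: ifPn => [/set_mem pD|pD]; rewrite /F /= indicE.
    by rewrite mem_set ?mulr1//= in_itv.
  by rewrite memNset ?mulr0//= in_itv/= => pD'; move/negP: pD; apply; exact: mem_set.
rewrite (fubini_tonelli1 (m1 := mu) (m2 := mu) _ mFE F0E).
transitivity (\int[mu]_s \int[mu]_t (EFin \o G) (s, t))%E.
  apply: ae_eq_integral => //.
  - exact: (measurable_fun_fubini_tonelli_F (m2 := mu) _ mFE F0E).
  - exact: (measurable_fun_fubini_tonelli_F (m2 := mu) _ mG G0).
  exists [set 0]; split; [by []|exact: lebesgue_measure_set1|].
  move=> s /= sP; apply: contrapT => /eqP s0; apply: sP => _.
  have mFs : measurable_fun setT (fun y => (F (s, y))%:E).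
    by apply: (measurableT_comp mFE); exact: pair1_measurable.
  have := ge0_integral_affine 0 s0 mFs (fun y => F0E (s, y)).
  move=> /(congr1 (fun X => (`|s|%:E * X)%E)).
  rewrite muleA -EFinM divff ?normr_eq0// mul1e /fubini_F/= => <-.
  rewrite -ge0_integralZl//.
  - by apply: eq_integral => t _; rewrite /G/= addr0 [s * t]mulrC.
  - apply: (measurableT_comp mFE); apply: measurable_fun_pair => //.
    by apply: measurable_funD => //; apply: measurable_funM.
  - by move=> t _; rewrite lee_fin.
rewrite (fubini_tonelli (m1 := mu) (m2 := mu) _ mG G0).
apply: eq_integral => t _.
set m := Num.sqrt (1 + t ^+ 2); have mp : 0 < m by rewrite sqrtr_gt0.
have m2 : m ^+ 2 = 1 + t ^+ 2 by rewrite sqr_sqrtr// ltW.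
have mH : measurable_fun setT (fun s => (H t s)%:E).
  apply/measurable_EFinP; apply: measurable_funM; last exact: measurable_indic.
  apply: measurable_funM; first by apply: measurable_funX; exact: normr_measurable.
  apply: measurable_funV; apply: measurable_funD; apply: measurable_funX => //.
  by apply: measurable_funD => //; exact: measurable_funX.
have H0 s : (0 <= (H t s)%:E)%E.
  by rewrite lee_fin mulr_ge0// divr_ge0 ?exprn_ge0// ltW// plasma_den_pos ?sqr_ge0.
have c0 : 0 <= Q (1, t) / (1 + t ^+ 2) / m.
  by rewrite divr_ge0 ?(ltW mp)// divr_ge0// ltW.
transitivity ((Q (1, t) / (1 + t ^+ 2) / m)%:E * \int[mu]_s (H t (m * s + 0))%:E)%E.
  rewrite -ge0_integralZl//.
  - by apply: eq_integral => s _; rewrite /= GE addr0 EFinM.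
  - exact: (measurableT_comp mH (@measurable_affine R m 0)).
have mn : m != 0 by rewrite gt_eqF.
have -> := ge0_integral_affine 0 mn mH H0.
rewrite radial_integral_even !muleA -!EFinM (gtr0_norm mp); congr (_%:E * _)%E.
by rewrite -m2; field; rewrite gt_eqF.
Qed.

End PlanarIntegral.

End SlopeCoordinates.

(** * Bounds for the integral over the disc *)

Section AngularBounds.
Context {R : realType}.
Local Notation mu := (@lebesgue_measure R).

Lemma measurable_radial_integral (k0 : R) :
  measurable_fun setT (fun x : measurableTypeR R => radial_integral k0 x).
Proof.
pose F (p : measurableTypeR R * measurableTypeR R) : \bar R :=
  (`|p.2| ^+ 3 / plasma_den p.1 (p.2 ^+ 2) * \1_(`[0, k0]) p.2)%:E.
have F0 p : (0 <= F p)%E.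
  by rewrite lee_fin mulr_ge0// divr_ge0 ?exprn_ge0// ltW// plasma_den_pos ?sqr_ge0.
have mF : measurable_fun setT F.
  apply/measurable_EFinP; apply: measurable_funM; last first.
    have mI : measurable_fun setT (\1_(`[0, k0]) : R -> R) by exact: measurable_indic.
    exact: (measurableT_comp mI).
  apply: measurable_funM.
    by apply: measurable_funX; apply: measurableT_comp => //; exact: normr_measurable.
  apply: measurable_funV; apply: measurable_funD; apply: measurable_funX.
    apply: measurable_funD; first exact: measurable_funX.
    exact: (measurableT_comp (@measurable_PsiR R)).
  exact: (measurableT_comp (@measurable_PsiI R)).
have := measurable_fun_fubini_tonelli_F (m2 := mu) _ mF F0.
congr measurable_fun; apply/funext => x; rewrite /fubini_F /radial_integral.
rewrite [RHS]integral_mkcond; apply: eq_integral => s _.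
rewrite patchE /F indicE /=; case: ifPn => [/set_mem|_]; last by rewrite mulr0.
by rewrite /= in_itv/= => /andP[s0 _]; rewrite mulr1 ger0_norm.
Qed.

Lemma measurable_slope_proj (a b : R) : measurable_fun setT (slope_proj a b).
Proof.
apply: measurable_funM; first by apply: measurable_funD => //; apply: measurable_funM.
apply: measurable_funV; apply: measurable_sqrtf; exact: measurable_funD.
Qed.

Lemma measurable_slope_radial (k0 a b : R) (f : R -> R) : measurable_fun setT f ->
  measurable_fun setT (fun t => ((f t)%:E * radial_integral k0 (slope_proj a b t))%E).
Proof.
move=> mf; apply: emeasurable_funM; first exact/measurable_EFinP.
exact: (measurableT_comp (@measurable_radial_integral k0) (@measurable_slope_proj a b)).
Qed.

Lemma radial_integral_ge0 (k0 x : R) : (0 <= radial_integral k0 x)%E.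
Proof.
apply: integral_ge0 => s; rewrite /= in_itv/= => /andP[s0 _].
by rewrite lee_fin divr_ge0 ?exprn_ge0// ltW// plasma_den_gt0.
Qed.

(** With x and y the components of a vector of length r, the factor
    exp(- y^2/2) that remains of exp(x^2/2) pays for (1 + |x|)^-3 being larger
    than (1 + r)^-3, and still leaves 1/(1 + y^2). *)
Lemma weight_split (x y r : R) : 0 <= r -> r ^+ 2 = x ^+ 2 + y ^+ 2 ->
  resonance_weight x <=
  24 ^+ 3 * expR (r ^+ 2 / 2) / (1 + r) ^+ 3 / (1 + y ^+ 2).
Proof.
move=> r0 rxy.
have xp : 0 < 1 + `|x| by rewrite ltr_pwDl.
have yp : 0 < 1 + `|y| by rewrite ltr_pwDl.
have rp : 0 < 1 + r by rewrite ltr_pwDl.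
have y2p : 0 < 1 + y ^+ 2 by rewrite ltr_pwDl ?sqr_ge0.
have h1 : 1 + r <= (1 + `|x|) * (1 + `|y|).
  have : r <= `|x| + `|y|.
    rewrite -(@ler_pXn2r _ 2) ?nnegrE ?addr_ge0// rxy.
    rewrite -(real_normK (num_real x)) -(real_normK (num_real y)).
    by have := mulr_ge0 (normr_ge0 x) (normr_ge0 y); nra.
  by have := mulr_ge0 (normr_ge0 x) (normr_ge0 y); nra.
have h2 : (1 + r) ^+ 3 <= (1 + `|x|) ^+ 3 * (1 + `|y|) ^+ 3.
  by rewrite -exprMn lerXn2r ?nnegrE ?(ltW rp)// ltW// mulr_gt0.
have h3 : 1 + y ^+ 2 <= (1 + `|y|) ^+ 3.
  apply: (@le_trans _ _ ((1 + `|y|) ^+ 2)).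
    by rewrite -(real_normK (num_real y)); have := normr_ge0 y; nra.
  by rewrite ler_weXn2l// lerDl.
have h4 : (1 + `|y|) ^+ 3 * (1 + `|y|) ^+ 3 <= 24 ^+ 3 * expR (y ^+ 2 / 2).
  have := @poly_le_weight R y.
  by rewrite /resonance_weight mulrA ler_pdivlMr ?exprn_gt0.
have E : expR (r ^+ 2 / 2) = expR (x ^+ 2 / 2) * expR (y ^+ 2 / 2).
  by rewrite -expRD rxy mulrDl.
rewrite /resonance_weight ler_pdivlMr// ler_pdivlMr ?exprn_gt0// E.
rewrite -[leLHS]mulrA mulrAC ler_pdivrMr ?exprn_gt0//.
have -> : 24 ^+ 3 * (expR (x ^+ 2 / 2) * expR (y ^+ 2 / 2)) * (1 + `|x|) ^+ 3 =
  expR (x ^+ 2 / 2) * (24 ^+ 3 * expR (y ^+ 2 / 2) * (1 + `|x|) ^+ 3) by ring.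
rewrite ler_wpM2l ?expR_ge0//.
apply: (@le_trans _ _ ((1 + `|y|) ^+ 3 * ((1 + `|x|) ^+ 3 * (1 + `|y|) ^+ 3))).
  by rewrite ler_pM// ?exprn_ge0// ltW.
by rewrite mulrCA mulrC ler_wpM2r ?exprn_ge0// ltW.
Qed.

Lemma slope_proj_sqr (a b t : R) :
  a ^+ 2 + b ^+ 2 = slope_proj a b t ^+ 2 + (b - t * a) ^+ 2 / (1 + t ^+ 2).
Proof.
have tp : 0 < 1 + t ^+ 2 by rewrite ltr_pwDl ?sqr_ge0.
rewrite /slope_proj expr_div_n sqr_sqrtr ?ltW//.
by field; rewrite gt_eqF.
Qed.

(** The discriminant is - 4 (1 + a^2 + b^2): only the length of (a, b) enters. *)
Lemma integral_quadratic (a b : R) :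
  (\int[mu]_t ((1 + t ^+ 2 + (b - t * a) ^+ 2)^-1)%:E =
   (pi / Num.sqrt (1 + (a ^+ 2 + b ^+ 2)))%:E)%E.
Proof.
set w := Num.sqrt _.
have sp : 0 < 1 + (a ^+ 2 + b ^+ 2) by rewrite ltr_pwDl// addr_ge0 ?sqr_ge0.
have wp : 0 < w by rewrite sqrtr_gt0.
have w2 : w ^+ 2 = 1 + (a ^+ 2 + b ^+ 2) by rewrite sqr_sqrtr// ltW.
have ap : 0 < 1 + a ^+ 2 by rewrite ltr_pwDl ?sqr_ge0.
pose c := w / (1 + a ^+ 2); pose d := a * b / (1 + a ^+ 2).
have cp : 0 < c by rewrite divr_gt0.
have cn : c != 0 by rewrite gt_eqF.
pose f (t : R) : \bar R := ((1 + t ^+ 2 + (b - t * a) ^+ 2)^-1)%:E.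
have mf : measurable_fun setT f.
  apply/measurable_EFinP; apply: measurable_funV; apply: measurable_funD.
    by apply: measurable_funD => //; exact: measurable_funX.
  apply: measurable_funX; apply: measurable_funB => //; exact: measurable_funM.
have f0 t : (0 <= f t)%E.
  by rewrite lee_fin invr_ge0 !addr_ge0 ?sqr_ge0.
have := ge0_integral_affine d cn mf f0.
have -> : (\int[mu]_t f (c * t + d)%R = ((1 + a ^+ 2) / w ^+ 2 * pi)%:E)%E.
  rewrite EFinM -integral_oneDsqr -ge0_integralZl//.
  - apply: eq_integral => t _; rewrite /f -EFinM; congr (_%:E).
    have tp : 0 < 1 + t ^+ 2 by rewrite ltr_pwDl ?sqr_ge0.
    have -> : 1 + (c * t + d) ^+ 2 + (b - (c * t + d) * a) ^+ 2 =
        w ^+ 2 / (1 + a ^+ 2) * (1 + t ^+ 2).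
      transitivity ((w ^+ 2 * t ^+ 2 + (1 + (a ^+ 2 + b ^+ 2))) / (1 + a ^+ 2)).
        by rewrite /c /d; field; rewrite gt_eqF.
      by rewrite -w2; field; rewrite gt_eqF.
    by field; rewrite !gt_eqF.
  - by apply/measurable_EFinP; apply: measurable_funV; apply: measurable_funD.
  - by move=> t _; rewrite lee_fin invr_ge0 addr_ge0 ?sqr_ge0.
  - by rewrite lee_fin divr_ge0// ltW// exprn_gt0.
rewrite (gtr0_norm cp) => /(congr1 (fun X => (c%:E * X)%E)).
have cc : (c%:E * (c^-1)%:E = 1)%E by rewrite -EFinM divff.
rewrite muleA cc mul1e -EFinM => <-; congr (_%:E).
by rewrite /c; field; rewrite !gt_eqF.
Qed.

Let m1 (t : R) : 0 < 1 + t ^+ 2. Proof. by rewrite ltr_pwDl ?sqr_ge0. Qed.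

(** By [weight_split] the integrand over the slopes is at most a multiple of
    1/((1 + t^2) (1 + y^2)), the function of [integral_quadratic]; the latter
    gains the fourth power of 1 + r. *)
Lemma planar_integral_le (k0 : R) : 0 < k0 -> exists2 C : R, 0 < C &
  forall a b, (\int[(mu \x mu)%E]_(p in disc k0)
      ((p.1 ^+ 2 + p.2 ^+ 2) / planar_den a b p)%:E <=
    (C * expR ((a ^+ 2 + b ^+ 2) / 2) / (1 + Num.sqrt (a ^+ 2 + b ^+ 2)) ^+ 4)%:E)%E.
Proof.
move=> k00; have [C C0 hC] := radial_integral_le k00.
exists (4 * C * 24 ^+ 3 * pi); first by rewrite !mulr_gt0 ?pi_gt0 ?exprn_gt0.
move=> a b; set r := Num.sqrt _.
have ab0 : 0 <= a ^+ 2 + b ^+ 2 by rewrite addr_ge0 ?sqr_ge0.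
have r2 : r ^+ 2 = a ^+ 2 + b ^+ 2 by rewrite sqr_sqrtr.
have r0 : 0 <= r by exact: sqrtr_ge0.
have rp : 0 < 1 + r by rewrite ltr_pwDl.
rewrite planar_integral//=; first last.
- by apply: measurable_funD; apply: measurable_funX.
- by move=> s t; ring.
- by move=> p; rewrite addr_ge0 ?sqr_ge0.
pose K := 2 * C * 24 ^+ 3 * expR (r ^+ 2 / 2) / (1 + r) ^+ 3.
have K0 : 0 <= K by rewrite divr_ge0 ?exprn_ge0 ?(ltW rp)// !mulr_ge0 ?expR_ge0 ?exprn_ge0// ltW.
have mq : measurable_fun setT (fun t : R => (1 + t ^+ 2 + (b - t * a) ^+ 2)^-1).
  apply: measurable_funV; apply: measurable_funD; first exact: measurable_funD.
  by apply: measurable_funX; apply: measurable_funB => //; exact: measurable_funM.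
apply: (@le_trans _ _ (\int[mu]_t (K%:E * ((1 + t ^+ 2 + (b - t * a) ^+ 2)^-1)%:E))%E).
  apply: ge0_le_integral => //.
  - move=> t _; rewrite mule_ge0 ?radial_integral_ge0// lee_fin.
    by rewrite divr_ge0 ?sqr_ge0// mulr_ge0// addr_ge0 ?sqr_ge0.
  - apply: measurable_slope_radial; apply: measurable_funM.
      by apply: measurable_funM => //; apply: measurable_funD.
    by apply: measurable_funV; apply: measurable_funX; exact: measurable_funD.
  - by apply: measurable_funeM; exact/measurable_EFinP.
  move=> t _; have tp := m1 t.
  have c0 : 0 <= 2 * (1 ^+ 2 + t ^+ 2) / (1 + t ^+ 2) ^+ 2.
    by rewrite divr_ge0 ?sqr_ge0// mulr_ge0// addr_ge0 ?sqr_ge0.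
  apply: (@le_trans _ _ ((2 * (1 ^+ 2 + t ^+ 2) / (1 + t ^+ 2) ^+ 2)%:E *
      (C * resonance_weight (slope_proj a b t))%:E)%E).
    by rewrite lee_wpmul2l// lee_fin.
  rewrite -!EFinM lee_fin.
  pose y := (b - t * a) / Num.sqrt (1 + t ^+ 2).
  have y2 : y ^+ 2 = (b - t * a) ^+ 2 / (1 + t ^+ 2).
    by rewrite expr_div_n sqr_sqrtr// ltW.
  have rxy : r ^+ 2 = slope_proj a b t ^+ 2 + y ^+ 2 by rewrite r2 y2 -slope_proj_sqr.
  have h := weight_split r0 rxy.
  have yp : 0 < 1 + t ^+ 2 + (b - t * a) ^+ 2 by rewrite ltr_pwDl ?sqr_ge0.
  apply: (le_trans (ler_wpM2l c0 (ler_wpM2l (ltW C0) h))).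
  rewrite y2 /K le_eqVlt; apply/orP; left; apply/eqP.
  by field; rewrite !gt_eqF// mulr_gt0.
rewrite ge0_integralZl//; first last.
- by move=> t _; rewrite lee_fin invr_ge0 !addr_ge0 ?sqr_ge0.
- exact/measurable_EFinP.
rewrite integral_quadratic -EFinM lee_fin -r2.
set w := Num.sqrt (1 + r ^+ 2).
have wp : 0 < w by rewrite sqrtr_gt0 ltr_pwDl ?sqr_ge0.
have w2 : w ^+ 2 = 1 + r ^+ 2 by rewrite sqr_sqrtr// addr_ge0 ?sqr_ge0.
have w1 : 1 <= w by rewrite -(@ler_pXn2r _ 2) ?nnegrE ?(ltW wp)// w2 expr1n lerDl sqr_ge0.
have rw : r <= w by rewrite -(@ler_pXn2r _ 2) ?nnegrE ?(ltW wp)// w2 lerDr.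
have hw : 1 + r <= 2 * w by lra.
have -> : 4 * C * 24 ^+ 3 * pi * expR (r ^+ 2 / 2) / (1 + r) ^+ 4 = K * (pi * (2 / (1 + r))).
  by rewrite /K; field; rewrite gt_eqF.
rewrite ler_wpM2l// ler_wpM2l ?pi_ge0//.
by rewrite -[leLHS]div1r ler_pdivrMr// mulrAC ler_pdivlMr// mul1r.
Qed.

Lemma disc_swap (k0 : R) (F : measurableTypeR R * measurableTypeR R -> R) :
  measurable_fun setT F -> (forall p, 0 <= F p) ->
  (\int[(mu \x mu)%E]_(p in disc k0) (F p)%:E =
   \int[(mu \x mu)%E]_(p in disc k0) (F (p.2, p.1))%:E)%E.
Proof.
move=> mF F0.
pose G (p : measurableTypeR R * measurableTypeR R) : R :=
  F p * \1_(`]-oo, (k0 ^+ 2)]) (p.1 ^+ 2 + p.2 ^+ 2).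
have mI : measurable_fun setT (\1_(`]-oo, (k0 ^+ 2)]) : R -> R) by exact: measurable_indic.
have mG : measurable_fun setT (EFin \o G).
  apply/measurable_EFinP; apply: measurable_funM => //.
  by apply: (measurableT_comp mI); apply: measurable_funD; apply: measurable_funX.
have G0 p : (0 <= (EFin \o G) p)%E by rewrite lee_fin mulr_ge0 ?indicE ?ler0n.
have mswap : measurable_fun setT
    (fun p : measurableTypeR R * measurableTypeR R => (p.2, p.1)).
  exact: measurable_fun_pair.
have mG' : measurable_fun setT (fun p => (EFin \o G) (p.2, p.1)).
  exact: (measurableT_comp mG mswap).
have G0' p : (0 <= (EFin \o G) (p.2, p.1))%E by exact: G0.
have disc_indic (p : R * R) (c : R) :
    ((fun q : R * R => c%:E) \_ (disc k0)) p =
    (c * \1_(`]-oo, (k0 ^+ 2)]) (p.1 ^+ 2 + p.2 ^+ 2))%:E.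
  rewrite patchE; case: ifPn => [/set_mem pD|pD]; rewrite /= indicE.
    by rewrite mem_set ?mulr1//= in_itv.
  by rewrite memNset ?mulr0//= in_itv/= => pD'; move/negP: pD; apply; exact: mem_set.
transitivity (\int[(mu \x mu)%E]_p (EFin \o G) p)%E.
  rewrite integral_mkcond; apply: eq_integral => p _.
  by rewrite /G /= -(disc_indic p (F p)) !patchE.
transitivity (\int[(mu \x mu)%E]_p (EFin \o G) (p.2, p.1))%E; last first.
  rewrite [RHS]integral_mkcond; apply: eq_integral => p _.
  by rewrite /G /= [p.2 ^+ 2 + _]addrC -(disc_indic p (F (p.2, p.1))) !patchE.
rewrite (fubini_tonelli1 (m1 := mu) (m2 := mu) _ mG G0).
rewrite (fubini_tonelli2 (m1 := mu) (m2 := mu) _ mG' G0').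
by [].
Qed.

(** An affine function of t cannot be small on a whole interval of fixed
    length, in comparison with its coefficients. *)
Let integral_affine_sqr (alpha beta t0 eta : R) : 0 < eta -> eta <= 1 ->
  `|t0| <= 1 ->
  ((2 / 9 * eta ^+ 3 * (alpha ^+ 2 + beta ^+ 2))%:E <=
   \int[mu]_(t in `[(t0 - eta)%R, (t0 + eta)%R]) ((alpha + t * beta) ^+ 2)%:E)%E.
Proof.
move=> e0 e1 t01.
have cf : continuous (fun t : R => (alpha + t * beta) ^+ 2).
  by apply: derivable_continuous => t; apply: ex_derive.
have dF (t : R) : is_derive t 1 (fun t => alpha ^+ 2 * t + alpha * beta * t ^+ 2 +
    beta ^+ 2 * t ^+ 3 / 3) ((alpha + t * beta) ^+ 2).
  by apply: is_derive_eq; rewrite /GRing.scale/=; field.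
have le_e : t0 - eta <= t0 + eta by lra.
rewrite (integral_is_derive le_e cf dF) lee_fin.
set g := alpha + t0 * beta.
have -> : alpha ^+ 2 * (t0 + eta) + alpha * beta * (t0 + eta) ^+ 2 +
    beta ^+ 2 * (t0 + eta) ^+ 3 / 3 - (alpha ^+ 2 * (t0 - eta) +
    alpha * beta * (t0 - eta) ^+ 2 + beta ^+ 2 * (t0 - eta) ^+ 3 / 3) =
    2 * eta * g ^+ 2 + 2 / 3 * eta ^+ 3 * beta ^+ 2 by rewrite /g; field.
have t2 : t0 ^+ 2 <= 1 by rewrite -(real_normK (num_real t0)) expr_le1.
have h1 : alpha ^+ 2 <= 2 * g ^+ 2 + 2 * beta ^+ 2.
  have -> : alpha = g - t0 * beta by rewrite /g addrK.
  have := sqr_ge0 (g + t0 * beta); have := ler_wpM2r (sqr_ge0 beta) t2.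
  by rewrite -exprMn mul1r; lra.
have h2 : eta ^+ 3 <= eta by rewrite -[leRHS]expr1 ler_wiXn2l// ltW.
have e3 : 0 <= eta ^+ 3 by rewrite exprn_ge0// ltW.
have h3 := ler_wpM2l e3 h1.
have h4 := ler_wpM2r (sqr_ge0 g) h2.
have h5 := mulr_ge0 (ltW e0) (sqr_ge0 g).
lra.
Qed.

(** Exchanging the coordinates, assume |b| <= |a|, so that the slope t0 = b/a of
    the projection of v lies in [-1, 1].  For |t - t0| <= eta, with
    eta^2 = 1 - q, the component orthogonal to the direction of slope t has a
    square at most (1 - q) r^2, hence x^2 >= q r^2. *)
Lemma planar_integral_ge (k0 q : R) : 0 < k0 -> 0 < q -> q < 1 ->
  exists2 c : R, 0 < c & forall a b alpha beta,
  ((c * (alpha ^+ 2 + beta ^+ 2) * expR (q * (a ^+ 2 + b ^+ 2) / 2) /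
     (1 + Num.sqrt (a ^+ 2 + b ^+ 2)) ^+ 3)%:E <=
   \int[(mu \x mu)%E]_(p in disc k0)
      ((p.1 * alpha + p.2 * beta) ^+ 2 / planar_den a b p)%:E)%E.
Proof.
move=> k00 q0 q1; have [C C0 hC] := radial_integral_ge k00.
pose eta := Num.sqrt (1 - q).
have eta2 : eta ^+ 2 = 1 - q by rewrite sqr_sqrtr// subr_ge0 ltW.
have eta0 : 0 < eta by rewrite sqrtr_gt0 subr_gt0.
have eta1 : eta <= 1 by rewrite -(@expr_le1 _ 2)// ?eta2 ?(ltW eta0)//; lra.
exists (2 / 25 * C * (2 / 9 * eta ^+ 3)).
  by rewrite !mulr_gt0 ?exprn_gt0 ?invr_gt0.
have mQ alpha beta : measurable_fun setT (fun p : measurableTypeR R * measurableTypeR R =>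
    (p.1 * alpha + p.2 * beta) ^+ 2).
  by apply: measurable_funX; apply: measurable_funD; apply: measurable_funM.
suff main (a b alpha beta : R) : b ^+ 2 <= a ^+ 2 ->
  ((2 / 25 * C * (2 / 9 * eta ^+ 3) * (alpha ^+ 2 + beta ^+ 2) * expR (q * (a ^+ 2 + b ^+ 2) / 2) /
     (1 + Num.sqrt (a ^+ 2 + b ^+ 2)) ^+ 3)%:E <=
   \int[(mu \x mu)%E]_(p in disc k0)
      ((p.1 * alpha + p.2 * beta) ^+ 2 / planar_den a b p)%:E)%E.
  move=> a b alpha beta; have [|/ltW] := leP (b ^+ 2) (a ^+ 2); first exact: main.
  move=> /(main _ _ beta alpha).
  rewrite [b ^+ 2 + _]addrC [beta ^+ 2 + _]addrC => /le_trans; apply.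
  rewrite disc_swap; first last.
  - by move=> p; rewrite divr_ge0 ?sqr_ge0// ltW// plasma_den_pos// addr_ge0 ?sqr_ge0.
  - apply: measurable_funM => //; apply: measurable_funV; exact: measurable_planar_den.
  rewrite le_eqVlt; apply/orP; left; apply/eqP; apply: eq_integral => p _ /=.
  by rewrite /planar_den /= [p.2 * beta + _]addrC [p.2 * b + _]addrC [p.2 ^+ 2 + _]addrC.
move=> ba; set r := Num.sqrt _.
have ab0 : 0 <= a ^+ 2 + b ^+ 2 by rewrite addr_ge0 ?sqr_ge0.
have r2 : r ^+ 2 = a ^+ 2 + b ^+ 2 by rewrite sqr_sqrtr.
have r0 : 0 <= r by exact: sqrtr_ge0.
have rp : 0 < 1 + r by rewrite ltr_pwDl.
rewrite planar_integral//=; first last.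
- by move=> s t; ring.
- by move=> p; exact: sqr_ge0.
pose t0 := b / a.
have bE : b = t0 * a.
  have [a0|a0] := eqVneq a 0; last by rewrite /t0 divfK.
  by move: ba; rewrite a0 expr0n/= mulr0 => b0; apply/eqP; rewrite -sqrf_eq0 eq_le b0 sqr_ge0.
have t01 : `|t0| <= 1.
  rewrite -(@expr_le1 _ 2)// real_normK ?num_real// /t0 expr_div_n.
  have [a0|a0] := eqVneq a 0; first by rewrite a0 expr0n/= invr0 mulr0.
  by rewrite ler_pdivrMr ?mul1r// exprn_even_gt0.
pose K := 2 / 25 * C * expR (q * r ^+ 2 / 2) / (1 + r) ^+ 3.
have K0 : 0 <= K.
  by rewrite divr_ge0 ?exprn_ge0 ?(ltW rp)// !mulr_ge0 ?expR_ge0 ?invr_ge0// ltW.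
have mi : measurable_fun setT (fun t : R => ((2 * (1 * alpha + t * beta) ^+ 2 / (1 + t ^+ 2) ^+ 2)%:E *
   radial_integral k0 (slope_proj a b t))%E).
  apply: measurable_slope_radial; apply: measurable_funM.
    apply: measurable_funM => //; apply: measurable_funX; apply: measurable_funD => //.
    exact: measurable_funM.
  by apply: measurable_funV; apply: measurable_funX; exact: measurable_funD.
have i0 (t : R) : (0 <= (2 * (1 * alpha + t * beta) ^+ 2 / (1 + t ^+ 2) ^+ 2)%:E *
   radial_integral k0 (slope_proj a b t))%E.
  rewrite mule_ge0 ?radial_integral_ge0// lee_fin.
  by rewrite divr_ge0 ?sqr_ge0// mulr_ge0// sqr_ge0.
apply: (@le_trans _ _ (\int[mu]_(t in `[(t0 - eta)%R, (t0 + eta)%R])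
    ((2 * (1 * alpha + t * beta) ^+ 2 / (1 + t ^+ 2) ^+ 2)%:E *
   radial_integral k0 (slope_proj a b t)))%E); last first.
  exact: ge0_subset_integral.
apply: (@le_trans _ _ (\int[mu]_(t in `[(t0 - eta)%R, (t0 + eta)%R])
    (K%:E * ((alpha + t * beta) ^+ 2)%:E))%E).
  rewrite ge0_integralZl//; first last.
  - by move=> t _; rewrite lee_fin sqr_ge0.
  - apply: measurable_funTS; apply/measurable_EFinP; apply: measurable_funX.
    by apply: measurable_funD => //; exact: measurable_funM.
  apply: le_trans (lee_wpmul2l _ (integral_affine_sqr alpha beta eta0 eta1 t01)); last first.
    by rewrite lee_fin.
  rewrite -EFinM lee_fin /K -r2 le_eqVlt; apply/orP; left; apply/eqP.
  by field; rewrite gt_eqF.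
apply: ge0_le_integral => //.
- by move=> t _; rewrite mule_ge0// lee_fin sqr_ge0.
- apply: measurable_funTS; apply: measurable_funeM; apply/measurable_EFinP.
  by apply: measurable_funX; apply: measurable_funD => //; exact: measurable_funM.
- exact: measurable_funTS.
move=> t; rewrite /= in_itv/= => /andP[tl tr].
have dt : `|t - t0| <= eta by rewrite ler_norml; apply/andP; split; lra.
have t2 : `|t| <= 2.
  by move: t01 dt; rewrite !ler_norml => /andP[? ?] /andP[? ?]; apply/andP; split; lra.
have tp := m1 t.
have t5 : (1 + t ^+ 2) ^+ 2 <= 25.
  have -> : 25 = 5 ^+ 2 :> R by ring.
  rewrite lerXn2r ?nnegrE ?(ltW tp)// -(real_normK (num_real t)).
  by have := normr_ge0 t; nra.
set x := slope_proj a b t.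
have hx : x ^+ 2 + (b - t * a) ^+ 2 / (1 + t ^+ 2) = r ^+ 2 by rewrite r2 -slope_proj_sqr.
have y2 : (b - t * a) ^+ 2 / (1 + t ^+ 2) <= (1 - q) * r ^+ 2.
  rewrite bE -mulrBl exprMn -eta2.
  apply: (@le_trans _ _ ((t0 - t) ^+ 2 * a ^+ 2)).
    have X0 : 0 <= (t0 - t) ^+ 2 * a ^+ 2 by rewrite mulr_ge0 ?sqr_ge0.
    have t1 : 1 <= 1 + t ^+ 2 by rewrite lerDl sqr_ge0.
    by rewrite ler_pdivrMr// ler_peMr.
  apply: ler_pM; rewrite ?sqr_ge0//.
    by rewrite -(real_normK (num_real (t0 - t))) distrC lerXn2r ?nnegrE ?(ltW eta0).
  by rewrite r2 lerDl sqr_ge0.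
have xq : q * r ^+ 2 <= x ^+ 2 by lra.
have xr : `|x| <= r.
  rewrite -(@ler_pXn2r _ 2) ?nnegrE// real_normK ?num_real// -hx lerDl.
  by rewrite divr_ge0 ?sqr_ge0// ltW.
have w : expR (q * r ^+ 2 / 2) / (1 + r) ^+ 3 <= resonance_weight x.
  apply: ler_pM; rewrite ?expR_ge0 ?invr_ge0 ?exprn_ge0 ?(ltW rp)//.
    by rewrite ler_expR ler_pM2r ?invr_gt0.
  rewrite lef_pV2 ?posrE ?exprn_gt0//.
  by rewrite lerXn2r ?nnegrE ?addr_ge0// lerD2l.
have s0 : 0 <= 2 * (1 * alpha + t * beta) ^+ 2 / (1 + t ^+ 2) ^+ 2.
  by rewrite divr_ge0 ?sqr_ge0// mulr_ge0// sqr_ge0.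
apply: (@le_trans _ _ ((2 * (1 * alpha + t * beta) ^+ 2 / (1 + t ^+ 2) ^+ 2)%:E *
    (C * resonance_weight x)%:E)%E); last by rewrite lee_wpmul2l.
rewrite -!EFinM lee_fin mul1r.
have -> : K * (alpha + t * beta) ^+ 2 = 2 * (alpha + t * beta) ^+ 2 / 25 *
    (C * (expR (q * r ^+ 2 / 2) / (1 + r) ^+ 3)).
  by rewrite /K; field; rewrite gt_eqF.
apply: ler_pM.
- by rewrite divr_ge0// mulr_ge0// sqr_ge0.
- by rewrite mulr_ge0 ?(ltW C0)// divr_ge0 ?expR_ge0// exprn_ge0// ltW.
- have S0 : 0 <= 2 * (alpha + t * beta) ^+ 2 by rewrite mulr_ge0 ?sqr_ge0.
  by rewrite ler_wpM2l// lef_pV2 ?posrE ?exprn_gt0.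
- by rewrite ler_wpM2l// ltW.
Qed.

End AngularBounds.

(** * The kernel *)

Section KernelIntegrals.
Context {R : realType}.
Local Notation mu := (@lebesgue_measure R).
Variables (k0 : R) (v z : 'cV[R]_3).
Hypotheses (k00 : 0 < k0) (z0 : z <> 0).

Let e1 := (frame z).1.
Let e2 := (frame z).2.
Let a := dot e1 v.
Let b := dot e2 v.

Let coord (p : R * R) (i : 'I_3) : R := p.1 * e1 i 0 + p.2 * e2 i 0.

Let plane_vecE p i : plane_vec z p i 0 = coord p i.
Proof. by rewrite /plane_vec !mxE. Qed.

Let plane_vec_enorm p : enorm (plane_vec z p) = Num.sqrt (p.1 ^+ 2 + p.2 ^+ 2).
Proof. by rewrite -(plane_vec_norm z0) sqrtr_sqr ger0_norm ?enorm_ge0. Qed.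

Let disc_set : [set p | enorm (plane_vec z p) <= k0] = disc k0.
Proof.
apply/seteqP; split => p /=; rewrite /disc /= -(plane_vec_norm z0) ler_pXn2r ?nnegrE ?enorm_ge0 ?(ltW k00)//.
Qed.

(** At k = 0 both sides are 0, the numerator being 0. *)
Let kernel_integrand (p : R * R) i j :
  plane_vec z p i 0 * plane_vec z p j 0 / (enorm (plane_vec z p) ^+ 4 *
    ComplexField.Normc.normc (dispersion (plane_vec z p) v) ^+ 2) =
  coord p i * coord p j / planar_den a b p.
Proof.
rewrite -!plane_vecE; have [->|/eqP k_neq0] := eqVneq (plane_vec z p) 0.
  by rewrite !mxE !mul0r.
rewrite normc_dispersion// /planar_den /plasma_den.
by rewrite (plane_vec_norm z0) plane_vec_dot plane_vec_enorm.
Qed.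

Lemma BLkernelE i j : BLkernel k0 v z i j = (enorm z)^-1 *
  \int[(mu \x mu)%E]_(p in disc k0) (coord p i * coord p j / planar_den a b p).
Proof.
rewrite mxE /disc_integral disc_set; congr (_ * _).
by apply: eq_Rintegral => p _; rewrite kernel_integrand.
Qed.

Let den_pos p : 0 < planar_den a b p.
Proof. by rewrite plasma_den_pos// addr_ge0 ?sqr_ge0. Qed.

Let measurable_disc : measurable (disc k0 : set (measurableTypeR R * measurableTypeR R)).
Proof.
have m : measurable_fun setT
    (fun p : measurableTypeR R * measurableTypeR R => p.1 ^+ 2 + p.2 ^+ 2 : R).
  by apply: measurable_funD; apply: measurable_funX.
have := m measurableT `]-oo, (k0 ^+ 2)]%classic; rewrite setTI.
have -> : (fun p : measurableTypeR R * measurableTypeR R => p.1 ^+ 2 + p.2 ^+ 2) @^-1`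
    `]-oo, (k0 ^+ 2)]%classic = disc k0.
  by apply/seteqP; split => p /=; rewrite in_itv.
by apply; exact: measurable_itv.
Qed.

Let mcoord i : measurable_fun setT
  (fun p : measurableTypeR R * measurableTypeR R => coord p i).
Proof. by apply: measurable_funD; apply: measurable_funM. Qed.

Let measurable_entry i j : measurable_fun setT
  (fun p : measurableTypeR R * measurableTypeR R => coord p i * coord p j / planar_den a b p).
Proof.
apply: measurable_funM; first exact: measurable_funM.
by apply: measurable_funV; exact: measurable_planar_den.
Qed.

(** Every entry of k k^t is at most |k|^2. *)
Let entry_le i j p : `|coord p i * coord p j / planar_den a b p| <=
  (p.1 ^+ 2 + p.2 ^+ 2) / planar_den a b p.
Proof.
have comp_le (w : 'cV[R]_3) l : `|w l 0| <= enorm w.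
  rewrite -(@ler_pXn2r _ 2) ?nnegrE ?enorm_ge0// real_normK ?num_real// enorm_sqr.
  rewrite /dot (bigD1 l)//= expr2 lerDl sumr_ge0// => m _.
  by rewrite -expr2 sqr_ge0.
rewrite normrM normfV (gtr0_norm (den_pos p)) ler_wpM2r ?invr_ge0 ?(ltW (den_pos p))//.
rewrite -!plane_vecE -(plane_vec_norm z0) normrM expr2.
by rewrite ler_pM.
Qed.

Let majorant_int_fin C : (\int[(mu \x mu)%E]_(p in disc k0)
      ((p.1 ^+ 2 + p.2 ^+ 2) / planar_den a b p)%:E <= C%:E)%E ->
  (mu \x mu)%E.-integrable (disc k0) (fun p : measurableTypeR R * measurableTypeR R =>
     ((p.1 ^+ 2 + p.2 ^+ 2) / planar_den a b p)%:E).
Proof.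
move=> hC; apply/integrableP; split.
  apply: measurable_funTS; apply/measurable_EFinP; apply: measurable_funM.
    by apply: measurable_funD; apply: measurable_funX.
  by apply: measurable_funV; exact: measurable_planar_den.
under eq_integral => p _.
  rewrite abse_EFin ger0_norm; last first.
    by rewrite divr_ge0 ?(ltW (den_pos p))// addr_ge0 ?sqr_ge0.
  over.
by apply: (le_lt_trans hC); rewrite ltry.
Qed.

Let integrable_entry i j : (mu \x mu)%E.-integrable (disc k0)
  (fun p : measurableTypeR R * measurableTypeR R =>
     (coord p i * coord p j / planar_den a b p)%:E).
Proof.
have [C _ hC] := planar_integral_le k00.
apply: le_integrable (majorant_int_fin (hC a b)) => //.
  by apply: measurable_funTS; apply/measurable_EFinP; exact: measurable_entry.
by move=> p _; rewrite !abse_EFin lee_fin (le_trans (entry_le i j p))// ler_norm.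
Qed.

Lemma BLkernel_norm_le C i j : (\int[(mu \x mu)%E]_(p in disc k0)
      ((p.1 ^+ 2 + p.2 ^+ 2) / planar_den a b p)%:E <= C%:E)%E ->
  `|BLkernel k0 v z i j| <= (enorm z)^-1 * C.
Proof.
move=> hC; rewrite BLkernelE normrM ger0_norm ?invr_ge0 ?enorm_ge0//.
rewrite ler_wpM2l ?invr_ge0 ?enorm_ge0//.
have ie := integrable_entry i j; have iM := majorant_int_fin hC.
apply: (le_trans (le_normr_Rintegral measurable_disc ie)).
rewrite -lee_fin /Rintegral fineK; last first.
  apply: integrable_fin_num => //.
  by have := integrable_abse ie; apply: eq_integrable => // p _; rewrite /= abse_EFin.
apply: le_trans hC; apply: le_integral => //.
- by have := integrable_abse ie; apply: eq_integrable => // p _; rewrite /= abse_EFin.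
- by move=> p _; rewrite lee_fin entry_le.
Qed.

Let fin_entry i j : (\int[(mu \x mu)%E]_(p in disc k0)
  (coord p i * coord p j / planar_den a b p)%:E)%E \is a fin_num.
Proof. exact: (integrable_fin_num measurable_disc (integrable_entry i j)). Qed.

(** Finite sums of integrable entries: the quadratic form of k k^t is the square
    of u.k. *)
Lemma BLkernel_quadratic (u : 'cV[R]_3) :
  ((u^T *m BLkernel k0 v z *m u) 0 0)%:E = ((enorm z)^-1%:E *
  \int[(mu \x mu)%E]_(p in disc k0)
     ((p.1 * dot e1 u + p.2 * dot e2 u) ^+ 2 / planar_den a b p)%:E)%E.
Proof.
have -> : (u^T *m BLkernel k0 v z *m u) 0 0 = (enorm z)^-1 *
  \sum_(i < 3) \sum_(j < 3) (u i 0 * u j 0) *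
     \int[(mu \x mu)%E]_(p in disc k0) (coord p i * coord p j / planar_den a b p).
  rewrite mxE mulr_sumr; under eq_bigr do rewrite mxE mulr_suml.
  rewrite exchange_big; apply: eq_bigr => i _; rewrite mulr_sumr.
  by apply: eq_bigr => j _; rewrite BLkernelE mxE; ring.
rewrite EFinM; congr (_ * _)%E.
transitivity (\sum_(i < 3) \sum_(j < 3) \int[(mu \x mu)%E]_(p in disc k0)
    ((u i 0 * u j 0)%:E * (coord p i * coord p j / planar_den a b p)%:E))%E.
  rewrite -sumEFin; apply: eq_bigr => i _; rewrite -sumEFin; apply: eq_bigr => j _.
  rewrite (integralZl measurable_disc (integrable_entry i j)).
  by rewrite EFinM /Rintegral fineK.
have iij i j : (mu \x mu)%E.-integrable (disc k0)
   (fun p : measurableTypeR R * measurableTypeR R =>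
     (u i 0 * u j 0)%:E * (coord p i * coord p j / planar_den a b p)%:E)%E.
  exact: (integrableZl measurable_disc _ (integrable_entry i j)).
under eq_bigr => i _ do rewrite -integral_sum//.
rewrite -integral_sum//; last first.
  by move=> i; apply: integrable_sum => //.
apply: eq_integral => p _.
under eq_bigr => i _.
  under eq_bigr => j _ do rewrite -EFinM.
  rewrite sumEFin; over.
rewrite sumEFin; congr (_%:E).
have -> : p.1 * dot e1 u + p.2 * dot e2 u = \sum_(i < 3) u i 0 * coord p i.
  rewrite /dot !mulr_sumr -big_split/=; apply: eq_bigr => i _.
  by rewrite /coord; ring.
rewrite expr2 mulr_suml mulr_suml; apply: eq_bigr => i _.
rewrite mulr_sumr mulr_suml; apply: eq_bigr => j _.
by ring.
Qed.

End KernelIntegrals.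

Unset Implicit Arguments.

Theorem theorem6 (R : realType) (k0 : R) (hk0 : 0 < k0) :
  (forall delta : R, 0 < delta -> delta < 1 ->
    exists Cdelta : R, 0 < Cdelta /\
      forall v vs : 'cV[R]_3, v <> vs -> forall i j : 'I_3,
        `|BLkernel k0 v (v - vs) i j|
          <= expR (1 / 2 * vR v (v - vs) ^+ 2) / enorm (v - vs)
             * Cdelta * (1 + vR v (v - vs)) `^ (- 3 - delta))
  /\
  (forall q : R, 0 < q -> q < 1 ->
    exists Cq : R, 0 < Cq /\
      forall (u v vs : 'cV[R]_3), v <> vs ->
        enorm (u - dirproj (v - vs) u) ^+ 2 / Cq
          * (expR (q / 2 * vR v (v - vs) ^+ 2) / enorm (v - vs))
          * (1 + vR v (v - vs)) ^- 3
        <= (u^T *m BLkernel k0 v (v - vs) *m u) 0 0).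
Proof.
split=> [delta d0 d1|q q0 q1].
  have [C C0 hC] := planar_integral_le hk0.
  exists C; split=> // v vs vvs i j.
  have z0 : v - vs <> 0 by move/eqP; rewrite subr_eq0 => /eqP.
  have zp : 0 < enorm (v - vs) by exact: enorm_gt0.
  apply: (le_trans (BLkernel_norm_le hk0 z0 i j (hC _ _))).
  rewrite (vR_frame z0); set r2 := dot _ v ^+ 2 + _; set r := Num.sqrt r2.
  have r0 : 0 <= r by exact: sqrtr_ge0.
  have rE : r ^+ 2 = r2 by rewrite sqr_sqrtr// addr_ge0 ?sqr_ge0.
  have rp : 0 < 1 + r by rewrite ltr_pwDl.
  (* 4 exceeds 3 + delta, and the base 1 + r is at least 1. *)
  have hpow : (1 + r) ^- 4 <= (1 + r) `^ (- 3 - delta).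
    have -> : (1 + r) ^- 4 = (1 + r) `^ (- 4).
      by rewrite powRN powR_mulrn// ltW.
    by rewrite ler_powR ?lerDl//; lra.
  rewrite rE.
  have -> : expR (1 / 2 * r2) / enorm (v - vs) * C = (enorm (v - vs))^-1 * (C * expR (r2 / 2)).
    by rewrite [1 / 2 * r2](_ : _ = r2 / 2); [ring|field].
  rewrite -[leRHS]mulrA ler_wpM2l ?invr_ge0 ?(ltW zp)// ler_wpM2l//.
  by rewrite mulr_ge0 ?expR_ge0// ltW.
have [c c0 hc] := planar_integral_ge hk0 q0 q1.
exists c^-1; split=> [|u v vs vvs]; first by rewrite invr_gt0.
have z0 : v - vs <> 0 by move/eqP; rewrite subr_eq0 => /eqP.
have zp : 0 < enorm (v - vs) by exact: enorm_gt0.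
rewrite (vR_frame z0) (enorm_dirproj z0) -lee_fin (BLkernel_quadratic v hk0 z0).
set r2 := dot _ v ^+ 2 + _; set r := Num.sqrt r2.
have rE : r ^+ 2 = r2 by rewrite sqr_sqrtr// addr_ge0 ?sqr_ge0.
apply: le_trans (lee_wpmul2l _ (hc _ _ _ _)); last by rewrite lee_fin invr_ge0 ltW.
rewrite -EFinM lee_fin -/r2 -/r rE invrK le_eqVlt; apply/orP; left; apply/eqP.
by rewrite [q / 2 * r2](_ : _ = q * r2 / 2); [ring|field].
Qed.
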